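(* Let $f:\widehat\Theta\to\mathbb{R}$ be continuous, let $(\tilde\Omega,\tilde{\mathcal F},\tilde{\mathbb P})$ be an atomless Polish probability space, let $t\in[0,T]$, and let $F(t,\cdot)$ be the lift of $f$ defined in the context. Assume that $F(t,\cdot)$ is Fréchet differentiable on $\mathbb L^2(\tilde\Omega;\widehat\Omega)$ and that $DF$ is continuous in the sense that $$\lim_{n\to\infty}\mathbb E^{\tilde{\mathbb P}}\big[|DF(t,\tilde X^n)-DF(t,\tilde X)|^2\big]=0\quad\text{whenever}\quad \lim_{n\to\infty}\mathbb E^{\tilde{\mathbb P}}\big[d_{SK}^2(\tilde X^n,\tilde X)\big]=0 .$$ Then for every $\tilde X\in\mathbb L^2(\tilde\Omega;\widehat\Omega)$ there exists an $\widehat{\mathcal F}_t$-measurable function $\psi:\widehat\Omega\to\mathbb{R}^d$ such that $DF(t,\tilde X)=\psi(\tilde X_{t\wedge\cdot})$, $\tilde{\mathbb P}$-a.s. Moreover, $\psi$ is determined by $f$ and the law $\tilde{\mathbb P}_{\tilde X}:=\tilde{\mathbb P}\circ\tilde X^{-1}$ (i.e. the same $\psi$ works for every $\tilde X'$ with $\tilde{\mathbb P}_{\tilde X'}=\tilde{\mathbb P}_{\tilde X}$), and $\psi$ is unique $\tilde{\mathbb P}_{\tilde X}$-a.s.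
   Context: Fix $T>0$, $d\ge1$. Let $\widehat\Omega=\mathbb D([0,T],\mathbb{R}^d)$ be the space of càdlàg paths, with canonical process $\widehat X$, natural filtration $\widehat{\mathbb F}=(\widehat{\mathcal F}_t)$, and Skorohod distance $d_{SK}(\widehat\omega,\widehat\omega')=\inf_\lambda\sup_{0\le t\le T}[|t-\lambda(t)|+|\widehat\omega_t-\widehat\omega'_{\lambda(t)}|]$, the infimum over continuous strictly increasing bijections $\lambda$ of $[0,T]$. Let $\widehat{\mathcal P}_2$ be the set of probability measures $\mu$ on $\widehat\Omega$ with $\mathbb E^\mu[\sup_t|\widehat X_t|^2]<\infty$, equipped with the 2-Wasserstein distance $\mathcal W_2(\mu,\nu)=\inf\big(\int d_{SK}^2(\omega_1,\omega_2)\,d\mathbb P(\omega_1,\omega_2)\big)^{1/2}$ over couplings $\mathbb P$ of $\mu,\nu$. For $\mu\in\widehat{\mathcal P}_2$, $\mu_{[0,t]}$ denotes the law of the stopped path $\widehat X_{t\wedge\cdot}$ under $\mu$. Let $\widehat\Theta=[0,T]\times\widehat{\mathcal P}_2$ with pseudometric $\mathcal W_2((t,\mu),(t',\mu'))=(|t-t'|+\mathcal W_2^2(\mu_{[0,t]},\mu'_{[0,t']}))^{1/2}$; continuity on $\widehat\Theta$ is with respect to it (so a continuous $f$ satisfies $f(t,\mu)=f(t,\mu_{[0,t]})$). $\mathbb L^2(\tilde\Omega;\widehat\Omega)$ is the set of $\tilde{\mathcal F}$-measurable $\tilde X:\tilde\Omega\to\widehat\Omega$ with $\mathbb E^{\tilde{\mathbb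 P}}[\sup_s|\tilde X_s|^2]<\infty$, and $\mathbb L^2(\tilde\Omega;\mathbb{R}^d)$ the square integrable $\mathbb{R}^d$-valued random variables. The lift is $F(t,\tilde X):=f(t,\tilde{\mathbb P}\circ\tilde X^{-1})$. $F(t,\cdot)$ is Fréchet differentiable at $\tilde X$ with derivative $DF(t,\tilde X)\in\mathbb L^2(\tilde\Omega;\mathbb{R}^d)$ if $F(t,\tilde X+\xi\mathbf 1_{[t,T]})-F(t,\tilde X)=\mathbb E^{\tilde{\mathbb P}}[DF(t,\tilde X)\cdot\xi]+o(\|\xi\|_2)$ for all $\xi\in\mathbb L^2(\tilde\Omega;\mathbb{R}^d)$, where $\|\xi\|_2^2=\mathbb E^{\tilde{\mathbb P}}[|\xi|^2]$. *)

(* Defs.v *)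
From HB Require Import structures.
From mathcomp Require Import all_boot all_order all_algebra.
From mathcomp Require Import all_classical all_reals all_analysis.
Unset Printing Implicit Defensive.
Import Order.TTheory GRing.Theory Num.Theory.
Import numFieldNormedType.Exports.
Local Open Scope classical_set_scope.
Local Open Scope ring_scope.

Definition eucl {R : realType} {d : nat} (x : 'rV[R]_d) : R :=
  Num.sqrt (\sum_(i < d) x ord0 i ^+ 2).
Definition dotv {R : realType} {d : nat} (x y : 'rV[R]_d) : R :=
  \sum_(i < d) x ord0 i * y ord0 i.

Definition borelRd (R : realType) (d : nat) : set (set 'rV[R]_d) :=
  <<s [set A : set 'rV[R]_d | open A] >>.

(* Cadlag paths on [0,T]: a path is a function R -> R^d which is       *)
(* cadlag on [0,T] and extended constantly outside [0,T]               *)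
(* (so that it is determined by its values on [0,T]).                  *)
Definition clampT {R : realType} (T s : R) : R := Num.max 0 (Num.min s T).
Definition ext {R : realType} {d : nat} (T : R) (g : R -> 'rV[R]_d) : R -> 'rV[R]_d :=
  fun s => g (clampT T s).

Definition is_cadlag {R : realType} {d : nat} (T : R) (g : R -> 'rV[R]_d) : Prop :=
  (forall s, 0 <= s < T -> g x @[x --> s^'+] --> g s) /\
  (forall s, 0 < s <= T -> exists l : 'rV[R]_d, g x @[x --> s^'-] --> l).

Definition cadlag_path {R : realType} {d : nat} (T : R) (g : R -> 'rV[R]_d) : Prop :=
  is_cadlag T g /\ ext T g = g.

Record cpath (R : realType) (T : R) (d : nat) := Path {
  pth :> R -> 'rV[R]_d ;
  pthP : cadlag_path T pth }.
Arguments cpath : clear implicits.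
Arguments Path : clear implicits.

Lemma cadlag_path0 (R : realType) (T : R) (d : nat) :
  cadlag_path T (fun _ : R => (0 : 'rV[R]_d)).
Proof.
split; last by [].
split=> s _; last exists 0; exact: cvg_cst.
Qed.

Definition path0 (R : realType) (T : R) (d : nat) : cpath R T d :=
  @Path R T d _ (@cadlag_path0 R T d).

HB.instance Definition _ (R : realType) (T : R) (d : nat) :=
  gen_eqMixin (cpath R T d).
HB.instance Definition _ (R : realType) (T : R) (d : nat) :=
  gen_choiceMixin (cpath R T d).
HB.instance Definition _ (R : realType) (T : R) (d : nat) :=
  isPointed.Build (cpath R T d) (@path0 R T d).

(* Build a path from the restriction to [0,T] of g (always cadlag in our uses:
   stopped paths and paths with an added jump). *)
Definition mkpath (R : realType) (T : R) (d : nat) (g : R -> 'rV[R]_d) : cpath R T d :=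
  match pselect (cadlag_path T (ext T g)) with
  | left h => @Path R T d _ h
  | right _ => @path0 R T d
  end.

Definition stop (R : realType) (T : R) (d : nat) (t : R) (w : cpath R T d) : cpath R T d :=
  mkpath R T d (fun s => w (Num.min s t)).

Definition shiftp (R : realType) (T : R) (d : nat) (t : R) (w : cpath R T d)
  (xi : 'rV[R]_d) : cpath R T d :=
  mkpath R T d (fun s => w s + (if t <= s then xi else 0)).

Definition coordG (R : realType) (T : R) (d : nat) (u : R) : set (set (cpath R T d)) :=
  [set A | exists s B, 0 <= s <= u /\ borelRd R d B /\
                       A = (fun w : cpath R T d => w s) @^-1` B].

Definition Fhat (R : realType) (T : R) (d : nat) (u : R) : set (set (cpath R T d)) :=
  <<s coordG R T d u >>.

Definition Omhat (R : realType) (T : R) (d : nat) := g_sigma_algebraType (coordG R T d T).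

Definition Fmeas (R : realType) (T : R) (d : nat) (u : R)
  (psi : cpath R T d -> 'rV[R]_d) : Prop :=
  forall B, borelRd R d B -> Fhat R T d u (psi @^-1` B).

Definition supn (R : realType) (T : R) (d : nat) (w : cpath R T d) : R :=
  sup [set eucl (w s) | s in [set s | 0 <= s <= T]].

Definition time_changes (R : realType) (T : R) : set (R -> R) :=
  [set lam : R -> R |
    {within [set s | 0 <= s <= T], continuous lam} /\
    (forall x y, 0 <= x <= T -> 0 <= y <= T -> x < y -> lam x < lam y) /\
    lam @` [set s | 0 <= s <= T] = [set s | 0 <= s <= T]].

Definition dSK (R : realType) (T : R) (d : nat) (w w' : cpath R T d) : R :=
  inf [set sup [set `|s - lam s| + eucl (w s - w' (lam s)) | s in [set s | 0 <= s <= T]]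
      | lam in time_changes R T].

(* Measures on \hat Omega are represented by set functions.            *)
Section Laws.
Variables (R : realType) (T : R) (d : nat).
Local Notation Om := (Omhat R T d).

Definition law {d0 : measure_display} {Omt : measurableType d0}
  (P : probability Omt R) (X : Omt -> Om) : set Om -> \bar R :=
  fun A => P (X @^-1` A).

Definition restr (mu : set Om -> \bar R) (t : R) : set Om -> \bar R :=
  fun A => mu (stop R T d t @^-1` A).

Definition P2 (mu : set Om -> \bar R) : Prop :=
  exists m : probability Om R,
    (forall A, measurable A -> m A = mu A) /\
    (\int[m]_w ((supn R T d w) ^+ 2)%:E < +oo)%E.

Definition coupling (Q : probability (Om * Om)%type R) (mu nu : set Om -> \bar R) : Prop :=
  forall A : set Om, measurable A ->
    Q (fst @^-1` A) = mu A /\ Q (snd @^-1` A) = nu A.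

Definition W2sq (mu nu : set Om -> \bar R) : \bar R :=
  ereal_inf [set (\int[Q]_z ((dSK R T d z.1 z.2) ^+ 2)%:E)%E
            | Q in [set Q | coupling Q mu nu]].

Definition W2Theta_sq (t : R) (mu : set Om -> \bar R) (t' : R) (mu' : set Om -> \bar R)
  : \bar R := ((`|t - t'|)%:E + W2sq (restr mu t) (restr mu' t'))%E.

Definition cont_Theta (f : R -> (set Om -> \bar R) -> R) : Prop :=
  forall t mu, 0 <= t <= T -> P2 mu ->
  forall e : R, 0 < e -> exists2 del : R, 0 < del &
    forall t' mu', 0 <= t' <= T -> P2 mu' ->
      (W2Theta_sq t mu t' mu' < (del ^+ 2)%:E)%E -> `|f t mu - f t' mu'| < e.

Context {d0 : measure_display} {Omt : measurableType d0} (P : probability Omt R).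

Definition L2path (X : Omt -> Om) : Prop :=
  measurable_fun setT X /\
  (\int[P]_w ((supn R T d (X w)) ^+ 2)%:E < +oo)%E.

Definition L2vec (Y : Omt -> 'rV[R]_d) : Prop :=
  (forall B, borelRd R d B -> measurable (Y @^-1` B)) /\
  (\int[P]_w ((eucl (Y w)) ^+ 2)%:E < +oo)%E.

Definition norm2 (Y : Omt -> 'rV[R]_d) : R :=
  Num.sqrt (fine (\int[P]_w ((eucl (Y w)) ^+ 2)%:E)).

Definition lift (f : R -> (set Om -> \bar R) -> R) (t : R) (X : Omt -> Om) : R :=
  f t (law P X).

Definition frechet_at (f : R -> (set Om -> \bar R) -> R) (t : R)
  (X : Omt -> Om) (D : Omt -> 'rV[R]_d) : Prop :=
  forall e : R, 0 < e -> exists2 del : R, 0 < del &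
    forall xi : Omt -> 'rV[R]_d, L2vec xi -> norm2 xi < del ->
      `| lift f t (fun w => (shiftp R T d t (X w) (xi w) : Om)) - lift f t X
         - fine (\int[P]_w (dotv (D w) (xi w))%:E) | <= e * norm2 xi.

End Laws.

Definition polish_measurable (R : realType) {d0 : measure_display}
  (Omt : measurableType d0) : Prop :=
  exists del : Omt -> Omt -> R,
    (forall x y, 0 <= del x y) /\ (forall x y, del x y = 0 <-> x = y) /\
    (forall x y, del x y = del y x) /\
    (forall x y z, del x z <= del x y + del y z) /\
    (forall u : nat -> Omt,
       (forall e : R, 0 < e -> exists N, forall m n, (N <= m)%N -> (N <= n)%N ->
          del (u m) (u n) < e) ->
       exists x, forall e : R, 0 < e -> exists N, forall n, (N <= n)%N -> del (u n) x < e) /\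
    (exists D : set Omt, countable D /\
       forall x (e : R), 0 < e -> exists2 y, D y & del x y < e) /\
    (@measurable _ Omt =
       <<s [set A : set Omt | forall x, A x ->
              exists2 e : R, 0 < e & [set y | del x y < e] `<=` A] >>).

Definition atomless (R : realType) {d0 : measure_display} {Omt : measurableType d0}
  (P : probability Omt R) : Prop :=
  forall A : set Omt, measurable A -> (0 < P A)%E ->
    exists B : set Omt, [/\ measurable B, B `<=` A & (0 < P B < P A)%E].

(* Main.v *)
(** Only the stopped law matters: if two pairs (X, xi), (X', xi') give the same law to
    the stopped perturbed path for all scalings of xi, then comparing the two first
    order expansions yields E[DF(X).xi] = E[DF(X').xi'].  Hence DF(X) = DF(X_{t/\.}).
    When X takes countably many values, an atomless space contains, inside a fiber
    {X = x}, disjoint sets A and B of equal probability; perturbing on A or on B gives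
    the same law, so DF(X) has equal integrals over A and B, and is therefore a.s.
    constant on the fiber.  A general stopped path is the Skorohod limit of its
    discretizations (grid values, rounded), so DF(X) is the L^2 limit of functions of
    the stopped path, and psi is the limsup along an a.s. convergent subsequence.
    If X' has the same law as X, testing with xi = (psi - psi')(X_{t/\.}) shows that
    the two factors agree. *)

Require Import Defs.
From HB Require Import structures.
From mathcomp Require Import all_boot all_order all_algebra.
From mathcomp Require Import all_classical all_reals all_analysis.
From mathcomp Require Import measurable_realfun ring lra.
Import Order.TTheory GRing.Theory Num.Theory.
Import numFieldNormedType.Exports.
Local Open Scope classical_set_scope.
Local Open Scope ring_scope.

(** Three obstacles shape the work. Reading a path on a grid moves its jumps to grid times, so a
    discretized path is near the original only after a change of time; this time change is glued
    from pieces on which the path oscillates little. Measurability of [dSK] is never established: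
    integrals of its square are treated as suprema over simple functions, both for the mean square
    convergence of discretizations and for the cost of a coupling carried by the diagonal. Finally,
    [psi] has to be measurable at time [t]: stopping precedes discretizing, so the integer code of a
    path reads it only up to [t]; since codes are countable, every function of the code, however
    chosen, is measurable, and a limsup stays measurable where the limit fails to exist. Equal
    integrals over equiprobable disjoint sets give constancy through a single threshold, the mean
    over the fiber: sets of positive probability strictly below and at or above it would contain, by
    Sierpinski's theorem, two sets of equal probability with different integrals. *)

(** * Euclidean norm and coordinatewise closeness *)

Section Euclidean.
Context {R : realType} {d : nat}.
Implicit Types x y z : 'rV[R]_d.

Lemma eucl_ge0 x : 0 <= eucl x.
Proof. exact: sqrtr_ge0. Qed.

Lemma eucl_sqr x : eucl x ^+ 2 = \sum_(i < d) x ord0 i ^+ 2.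
Proof. by rewrite sqr_sqrtr // sumr_ge0 // => i _; exact: sqr_ge0. Qed.

Lemma coord_le_eucl x i : `|x ord0 i| <= eucl x.
Proof.
rewrite -(@ler_pXn2r _ 2) ?nnegrE ?eucl_ge0 // eucl_sqr real_normK ?num_real //.
by rewrite (bigD1 i) //= lerDl sumr_ge0 // => j _; exact: sqr_ge0.
Qed.

Lemma eucl_le x (e : R) : (forall i, `|x ord0 i| <= e) -> eucl x <= d%:R * e.
Proof.
move=> xe; have [d0|d0] := posnP d.
  rewrite /eucl big1 ?sqrtr0 ?d0 ?mul0r // => i _.
  by have := ltn_ord i; rewrite {2}d0 ltn0.
have e0 : 0 <= e by exact: le_trans (normr_ge0 _) (xe (Ordinal d0)).
rewrite -(@ler_pXn2r _ 2) ?nnegrE ?eucl_ge0 ?mulr_ge0 // eucl_sqr.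
apply: (@le_trans _ _ (\sum_(i < d) e ^+ 2)).
  apply: ler_sum => i _; rewrite -real_normK ?num_real //.
  by rewrite ler_pXn2r ?nnegrE.
rewrite sumr_const card_ord exprMn -[leLHS]mulr_natl ler_wpM2r ?sqr_ge0 //.
by rewrite expr2 ler_peMr // ler1n.
Qed.

Lemma eucl_sqrD x y : eucl (x + y) ^+ 2 <= 2 * eucl x ^+ 2 + 2 * eucl y ^+ 2.
Proof.
rewrite !eucl_sqr !mulr_sumr -big_split /=; apply: ler_sum => i _.
rewrite mxE -subr_ge0.
rewrite (_ : _ - _ = (x ord0 i - y ord0 i) ^+ 2) ?sqr_ge0 //; ring.
Qed.

Lemma euclZ (c : R) x : eucl (c *: x) = `|c| * eucl x.
Proof.
rewrite /eucl -sqrtr_sqr -sqrtrM ?sqr_ge0 // mulr_sumr; congr Num.sqrt.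
by apply: eq_bigr => i _; rewrite mxE exprMn.
Qed.

Lemma euclN x : eucl (- x) = eucl x.
Proof. by rewrite -scaleN1r euclZ normrN1 mul1r. Qed.

Lemma eucl0 : eucl (0 : 'rV[R]_d) = 0.
Proof. by rewrite -(scale0r 0) euclZ normr0 mul0r. Qed.

Lemma eucl_sqrB x y : eucl (x - y) ^+ 2 <= 2 * eucl x ^+ 2 + 2 * eucl y ^+ 2.
Proof. by rewrite (le_trans (eucl_sqrD _ _)) // euclN. Qed.

(** The factor 2 comes from [eucl_sqrD] and stands in for the sharp triangle inequality; this is
    harmless because the bound only serves boundedness and domination. *)
Lemma eucl_leD x y : eucl (x + y) <= 2 * (eucl x + eucl y).
Proof.
have := eucl_sqrD x y; have := eucl_ge0 x; have := eucl_ge0 y.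
have := eucl_ge0 (x + y) => h0 hy hx h.
rewrite -(@ler_pXn2r _ 2) ?nnegrE //; last by apply: mulr_ge0 => //; exact: addr_ge0.
apply: (le_trans h); nra.
Qed.

Lemma eucl_eq0 x : eucl x ^+ 2 = 0 -> x = 0.
Proof.
rewrite eucl_sqr => /eqP.
rewrite psumr_eq0; last by move=> i _; exact: sqr_ge0.
move=> /allP h; apply/rowP => i; rewrite mxE.
by have /(_ (mem_index_enum i)) := h i; rewrite sqrf_eq0 => /eqP.
Qed.

Lemma dotvv x : dotv x x = eucl x ^+ 2.
Proof. by rewrite eucl_sqr; apply: eq_bigr => i _; rewrite expr2. Qed.

Lemma dotvBl x y z : dotv (x - y) z = dotv x z - dotv y z.
Proof.
by rewrite /dotv -sumrB; apply: eq_bigr => i _; rewrite !mxE mulrBl.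
Qed.

Lemma dotvZr (c : R) x y : dotv x (c *: y) = c * dotv x y.
Proof.
by rewrite /dotv mulr_sumr; apply: eq_bigr => i _; rewrite mxE mulrCA.
Qed.

(** A termwise bound in place of Cauchy-Schwarz, enough to make dot products of square integrable
    vectors integrable. *)
Lemma dotv_le x y : `|dotv x y| <= eucl x ^+ 2 + eucl y ^+ 2.
Proof.
rewrite !eucl_sqr -big_split /= (le_trans (ler_norm_sum _ _ _)) //.
apply: ler_sum => i _; rewrite ler_norml; apply/andP; split; nra.
Qed.

(** For positive radius this is the ball of the matrix topology. Limits are handled in this form,
    and the passage to [eucl] costs a factor [d]. *)
Definition close (e : R) x y := forall i, `|x ord0 i - y ord0 i| < e.

Lemma closeC e x y : close e x y -> close e y x.
Proof. by move=> h i; rewrite distrC. Qed.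

Lemma close_trans e1 e2 x y z : close e1 x y -> close e2 y z -> close (e1 + e2) x z.
Proof.
move=> h1 h2 i; have := h1 i; have := h2 i.
rewrite !ltr_norml => /andP[? ?] /andP[? ?]; apply/andP; split; lra.
Qed.

Lemma close_eucl e x y : close e x y -> eucl (x - y) <= d%:R * e.
Proof. by move=> h; apply: eucl_le => i; rewrite !mxE ltW. Qed.

Lemma ball_close x e y : 0 < e -> ball x e y <-> close e x y.
Proof.
move=> e0; split=> [[_ h] i|h]; first exact: h.
by split=> // i j; rewrite (ord1 i); exact: h.
Qed.

Lemma cvg_closeP {U : Type} (F : set_system U) {FF : Filter F} (g : U -> 'rV[R]_d) x :
  g @ F --> x <-> forall e, 0 < e -> \forall u \near F, close e x (g u).
Proof.
split=> [h e e0|h].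
  have := h _ (nbhsx_ballx x e e0); rewrite /= => hb.
  by apply: filterS hb => u /(ball_close _ _ _ e0).
apply/cvg_ballP => e e0; apply: filterS (h e e0) => u.
by move/(ball_close _ _ _ e0).
Qed.

End Euclidean.

(** * Cadlag paths, stopping, and adding a jump *)

Section Paths.
Context {R : realType} {T : R} {d : nat} (T_gt0 : 0 < T).
Local Notation path := (cpath R T d).
Implicit Types (w : path) (s t : R) (g : R -> 'rV[R]_d).

Lemma clampT_id s : 0 <= s <= T -> clampT T s = s.
Proof. by move=> /andP[s0 sT]; rewrite /clampT (min_l sT) (max_r s0). Qed.

Lemma clampT_itv s : 0 <= clampT T s <= T.
Proof.
by rewrite /clampT le_max lexx /= ge_max (ltW T_gt0) /= ge_min lexx orbT.
Qed.

Lemma pth_clampT w s : w (clampT T s) = w s.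
Proof. by case: w => g [_ h] /=; rewrite -{2}h. Qed.

Lemma pth_le0 w s : s <= 0 -> w s = w 0.
Proof.
move=> s0; rewrite -pth_clampT; congr (pth _ _ _ w _).
by rewrite /clampT (min_l (le_trans s0 (ltW T_gt0))) max_l.
Qed.

Lemma pth_geT w s : T <= s -> w s = w T.
Proof.
move=> s0; rewrite -pth_clampT; congr (pth _ _ _ w _).
by rewrite /clampT (min_r s0) (max_r (ltW T_gt0)).
Qed.

Lemma path_ext w w' : (forall s, 0 <= s <= T -> w s = w' s) -> w = w'.
Proof.
move=> h; have : pth _ _ _ w = pth _ _ _ w'.
  apply/funext => s; rewrite -pth_clampT -[RHS]pth_clampT.
  exact: h (clampT_itv s).
case: w w' {h} => g p [g' p'] /= e; subst g'.
by rewrite (Prop_irrelevance p p').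
Qed.

(** Constancy outside [[0, T]] extends right continuity, and in [pth_left] the left limits, to the
    whole line, so that later arguments need no endpoint cases. *)
Lemma pth_right w s : w x @[x --> s^'+] --> w s.
Proof.
have [sT|Ts] := ltP s T; last first.
  apply/cvg_closeP => e e0; near=> x.
  rewrite (pth_geT w s) // (pth_geT w x); last first.
    by apply: le_trans Ts _; apply: ltW; near: x; exact: nbhs_right_gt.
  by move=> i; rewrite subrr normr0.
have [s0|s0] := leP 0 s.
  by case: w => g [[h _] _] /=; apply: h; rewrite s0.
apply/cvg_closeP => e e0; near=> x.
rewrite (pth_le0 w s) ?ltW // (pth_le0 w x); last first.
  by apply: ltW; near: x; exact: nbhs_right_lt.
by move=> i; rewrite subrr normr0.
Unshelve. all: by end_near. Qed.

Lemma pth_left w s : exists l : 'rV[R]_d, w x @[x --> s^'-] --> l.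
Proof.
have [s0|s0] := leP s 0.
  exists (w 0); apply/cvg_closeP => e e0; near=> x.
  rewrite (pth_le0 w x); last first.
    by apply: le_trans s0; apply: ltW; near: x; exact: nbhs_left_lt.
  by move=> i; rewrite subrr normr0.
have [sT|Ts] := leP s T.
  by case: w => g [[_ h] _] /=; apply: h; rewrite s0.
exists (w T); apply/cvg_closeP => e e0; near=> x.
rewrite (pth_geT w x).
  by move=> i; rewrite subrr normr0.
by apply: ltW; near: x; exact: nbhs_left_gt.
Unshelve. all: by end_near. Qed.

(** [mkpath] returns the zero path on functions that are not cadlag; every use of [stop], [shiftp]
    and [decode] goes through this lemma to exclude that default. *)
Lemma mkpathE g : is_cadlag T g -> mkpath R T d g = ext T g :> (R -> 'rV[R]_d).
Proof.
move=> [hr hl]; rewrite /mkpath; case: pselect => //= -[]; split; last first.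
  by apply/funext => s; rewrite /ext clampT_id // clampT_itv.
split=> s /andP[s0 sT].
  rewrite /ext clampT_id ?s0 ?(ltW sT) //.
  apply: cvg_trans (hr s _); last by rewrite s0.
  apply: near_eq_cvg; near=> x; rewrite clampT_id //; apply/andP; split.
    by apply: le_trans s0 _; apply: ltW; near: x; exact: nbhs_right_gt.
  by apply: ltW; near: x; exact: nbhs_right_lt.
have [|l hl'] := hl s; first by rewrite s0.
exists l; apply: cvg_trans hl'; apply: near_eq_cvg; near=> x.
rewrite /ext clampT_id //; apply/andP; split.
  by apply: ltW; near: x; exact: nbhs_left_gt.
by apply: le_trans sT; apply: ltW; near: x; exact: nbhs_left_lt.
Unshelve. all: by end_near. Qed.

Lemma stopE t w s : 0 <= t <= T -> stop R T d t w s = w (Num.min s t).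
Proof.
move=> /andP[t0 tT]; rewrite /stop mkpathE.
  rewrite /ext -[RHS]pth_clampT; congr (pth _ _ _ w _).
  rewrite /clampT; have [st|ts] := leP s t.
    by rewrite (min_l (le_trans st tT)) min_l // ge_max t0.
  rewrite (min_l tT) (max_r t0) min_r //.
  by rewrite le_max le_min (ltW ts) tT orbT.
split=> u /andP[u0 uT] /=.
  have [ut|tu] := ltP u t.
    apply: cvg_trans (pth_right w u).
    apply: near_eq_cvg; near=> x; rewrite min_l //.
    by apply: ltW; near: x; exact: nbhs_right_lt.
  apply/cvg_closeP => e e0; near=> x.
  rewrite min_r; first by move=> i; rewrite subrr normr0.
  by apply: le_trans tu _; apply: ltW; near: x; exact: nbhs_right_gt.
have [ut|tu] := leP u t.
  have [l hl] := pth_left w u; exists l; apply: cvg_trans hl.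
  apply: near_eq_cvg; near=> x; rewrite min_l //.
  by apply: le_trans ut; apply: ltW; near: x; exact: nbhs_left_lt.
exists (w t); apply/cvg_closeP => e e0; near=> x.
rewrite min_r; first by move=> i; rewrite subrr normr0.
by apply: ltW; near: x; exact: nbhs_left_gt.
Unshelve. all: by end_near. Qed.

Lemma step_right t (v : 'rV[R]_d) s :
  (if t <= x then v else 0) @[x --> s^'+] --> (if t <= s then v else 0 : 'rV[R]_d).
Proof.
apply/cvg_closeP => e e0; have [ts|st] := leP t s; near=> x; last first.
  suff -> : (t <= x) = false by move=> i; rewrite subrr normr0.
  by apply/negbTE; rewrite -ltNge; near: x; exact: nbhs_right_lt.
suff -> : t <= x by move=> i; rewrite subrr normr0.
by apply: le_trans ts _; apply: ltW; near: x; exact: nbhs_right_gt.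
Unshelve. all: by end_near. Qed.

Lemma step_left t (v : 'rV[R]_d) s :
  (if t <= x then v else 0) @[x --> s^'-] --> (if t < s then v else 0 : 'rV[R]_d).
Proof.
apply/cvg_closeP => e e0; have [ts|st] := ltP t s; near=> x; last first.
  suff -> : (t <= x) = false by move=> i; rewrite subrr normr0.
  apply/negbTE; rewrite -ltNge; apply: lt_le_trans st.
  by near: x; exact: nbhs_left_lt.
suff -> : t <= x by move=> i; rewrite subrr normr0.
by apply: ltW; near: x; exact: nbhs_left_gt.
Unshelve. all: by end_near. Qed.

Lemma cvg_addrV {U : Type} (F : set_system U) {FF : Filter F} (g g' : U -> 'rV[R]_d)
    (x y : 'rV[R]_d) :
  g @ F --> x -> g' @ F --> y -> (fun u => g u + g' u) @ F --> x + y.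
Proof.
move=> /cvg_closeP h /cvg_closeP h'; apply/cvg_closeP => e e0.
have e2 : 0 < e / 2 by rewrite divr_gt0.
near=> u.
have c1 : close (e / 2) x (g u) by near: u; exact: h.
have c2 : close (e / 2) y (g' u) by near: u; exact: h'.
move=> i; rewrite !mxE opprD addrACA (splitr e).
by apply: le_lt_trans (ler_normD _ _) _; exact: ltrD (c1 i) (c2 i).
Unshelve. all: by end_near. Qed.

(** The clamp in the test matters at negative [s] when [t] is 0: the jump then belongs to the value
    at 0, which is extended to the left. *)
Lemma shiftpE t w (v : 'rV[R]_d) s :
  shiftp R T d t w v s = w s + (if t <= clampT T s then v else 0).
Proof.
rewrite /shiftp mkpathE; first by rewrite /ext pth_clampT.
split=> u _.
  apply: cvg_addrV; [exact: pth_right|exact: step_right].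
have [l hl] := pth_left w u; exists (l + if t < u then v else 0).
by apply: cvg_addrV => //; exact: step_left.
Qed.

Lemma stop_idem t w : 0 <= t <= T -> stop R T d t (stop R T d t w) = stop R T d t w.
Proof.
by move=> tT; apply: path_ext => s _; rewrite !stopE // -minA minxx.
Qed.

(** The jump occurs at [t] itself, so stopping at [t] keeps it while reading [w] only up to [t].
    This is why perturbations see nothing but the stopped path. *)
Lemma stop_shiftp_stop t w v : 0 <= t <= T ->
  stop R T d t (shiftp R T d t (stop R T d t w) v) = stop R T d t (shiftp R T d t w v).
Proof.
move=> tT; apply: path_ext => s sT; rewrite !(stopE, shiftpE) //.
by rewrite -minA minxx.
Qed.

End Paths.

(** * Skorohod approximation of a path by its values on a grid *)

Section Grid.
Context {R : realType} {T : R} {d : nat} (T_gt0 : 0 < T).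
Local Notation path := (cpath R T d).
Implicit Types (w : path) (s b e : R) (n : nat).

Definition mesh n : R := T / n.+1%:R.
Definition gridfloor n s : R := mesh n * (Num.floor (s / mesh n))%:~R.
Definition gridceil n s : R := mesh n * (Num.ceil (s / mesh n))%:~R.

Lemma mesh_gt0 n : 0 < mesh n.
Proof. by rewrite divr_gt0. Qed.

Lemma mesh_near e : 0 < e -> \forall n \near \oo, mesh n < e.
Proof.
move=> e0; have eT : 0 < e / T by rewrite divr_gt0.
near=> n; rewrite /mesh mulrC -ltr_pdivlMr //.
by near: n; exact: (near_infty_natSinv_lt (PosNum eT)).
Unshelve. all: by end_near. Qed.

Lemma gridceil_ge n s : s <= gridceil n s.
Proof. by rewrite /gridceil mulrC -ler_pdivrMr ?mesh_gt0 // ceil_ge. Qed.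

Lemma gridceil_lt n s : gridceil n s < s + mesh n.
Proof.
have h := ceilB1_lt (s / mesh n); rewrite ltr_pdivlMr ?mesh_gt0 // in h.
by move: h; rewrite rmorphB /= mulrBl mul1r ltrBlDr mulrC.
Qed.

Lemma gridceil0 n : gridceil n 0 = 0.
Proof. by rewrite /gridceil mul0r ceil0 mulr0. Qed.

Lemma gridceilT n : gridceil n T = T.
Proof.
rewrite /gridceil /mesh invf_div mulrCA divff ?gt_eqF // mulr1.
rewrite (_ : n.+1%:R = (Posz n.+1)%:~R) // ceilK ?rpred_int //.
by rewrite divfK // intr_eq0.
Qed.

Lemma gridfloor_le n s : gridfloor n s <= s.
Proof. by rewrite /gridfloor mulrC -ler_pdivlMr ?mesh_gt0 // floor_le. Qed.

(** With [gridfloor_ge] this is an adjunction: the times whose grid floor lies in [[b, b'[] are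
    exactly those of [[gridceil n b, gridceil n b'[]. Hence a breakpoint [b] of the path is matched
    with the time [gridceil n b]. *)
Lemma gridfloor_lt_gridceil n s b : s < gridceil n b -> gridfloor n s < b.
Proof.
rewrite /gridceil mulrC -ltr_pdivrMr ?mesh_gt0 // -floor_lt_int ceil_gt_int.
by rewrite ltr_pdivlMr ?mesh_gt0 // mulrC.
Qed.

Lemma gridfloor_ge n s b : gridceil n b <= s -> b <= gridfloor n s.
Proof.
rewrite /gridceil mulrC -ler_pdivlMr ?mesh_gt0 // -floor_ge_int => h.
apply: (le_trans (gridceil_ge n b)).
by rewrite /gridceil /gridfloor ler_pM2l ?mesh_gt0 // ler_int.
Qed.

(* [lam] is a time change of [0, gridceil n b] onto [0, b], extended to the
   whole line so that it can be glued with an affine piece. *)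
Definition grid_change w e n b (lam : R -> R) : Prop :=
  [/\ continuous lam, {homo lam : x y / x < y}, lam 0 = 0, lam (gridceil n b) = b &
      (forall s, 0 <= s <= gridceil n b -> `|s - lam s| <= mesh n) /\
      (forall s, 0 <= s < gridceil n b -> close e (w (lam s)) (w (gridfloor n s)))].

Lemma grid_change0 w e n : grid_change w e n 0 id.
Proof.
split; [by move=> s; exact: cvg_id|by []|by []|exact: gridceil0|rewrite gridceil0].
split=> s; last by move=> /andP[/le_lt_trans h /h]; rewrite ltxx.
by move=> _; rewrite subrr normr0 ltW // mesh_gt0.
Qed.

(** An affine piece carrying [[gridceil n b, gridceil n b']] onto [[b, b']] is glued to [lam]. On it
    both [lam' s] and [gridfloor n s] fall in [[b, b'[], where the oscillation of [w] is below
    [e]. *)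
Lemma grid_change_step w e n b b' lam : b < b' -> mesh n < b' - b -> 0 <= b ->
  (forall x y, b <= x < b' -> b <= y < b' -> close e (w x) (w y)) ->
  grid_change w e n b lam -> exists lam', grid_change w e n b' lam'.
Proof.
move=> bb' hn b0 osc [clam mlam lam0 lamb [near_id cl]].
set g := gridceil n b in lamb near_id cl; set g' := gridceil n b'.
have gb : b <= g by exact: gridceil_ge.
have gb2 : g < b + mesh n by exact: gridceil_lt.
have gb' : b' <= g' by exact: gridceil_ge.
have gb2' : g' < b' + mesh n by exact: gridceil_lt.
(* The mesh condition enters here: [g < b + mesh n < b' <= g'], so the new piece is not
   degenerate. *)
have gg' : 0 < g' - g by lra.
pose c := (b' - b) / (g' - g).
have c0 : 0 < c by apply: divr_gt0 => //; rewrite subr_gt0.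
have cE : c * (g' - g) = b' - b by rewrite /c divfK // gt_eqF.
(* Using [Num.min s g] writes the glued function as one sum, whose continuity needs no argument at
   the junction. *)
pose lam' s := lam (Num.min s g) + c * (s - Num.min s g).
have lamL s : s <= g -> lam' s = lam s by move=> sg; rewrite /lam' min_l // subrr mulr0 addr0.
have lamR s : g <= s -> lam' s = b + c * (s - g) by move=> sg; rewrite /lam' min_r // lamb.
have cmin : continuous (fun s => Num.min s g : R).
  move=> s; apply: (@continuous_min _ _ (fun x => x : R^o) (fun=> g : R^o)).
    exact: cvg_id.
  exact: cvg_cst.
exists lam'; split.
- move=> s; apply: (@cvgD _ R^o).
    apply: (cvg_comp (fun s : R => Num.min s g) lam); [exact: cmin|exact: clam].
  apply: (@cvgM R); first exact: cvg_cst.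
  apply: (@cvgB _ R^o); first exact: cvg_id.
  exact: cmin.
- move=> x y xy; have [yg|gy] := leP y g.
    by rewrite !lamL //; [exact: mlam|lra].
  have [xg|gx] := leP x g; last first.
    by rewrite (lamR x) 1?ltW // (lamR y) 1?ltW //; nra.
  rewrite lamL // lamR 1?ltW //; apply: (@le_lt_trans _ _ b); last by nra.
  by rewrite -lamb; have [->//|xg'] := eqVneq x g; apply/ltW/mlam; rewrite lt_neqAle xg'.
- by rewrite lamL //; lra.
- by rewrite -/g' lamR ?cE; lra.
rewrite -/g'; split=> s /andP[s0 sg'].
  have [sg|gs] := leP s g; first by rewrite lamL // near_id ?s0.
  rewrite (lamR s (ltW gs)).
  (* The displacement is a convex combination of those at the two endpoints, [g - b] and [g' - b'],
     and both lie between 0 and the mesh. *)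
  have -> : s - (b + c * (s - g)) =
     ((g' - s) * (g - b) + (s - g) * (g' - b')) / (g' - g).
    by rewrite /c; field; lra.
  rewrite ger0_norm; last by apply: divr_ge0; nra.
  rewrite ler_pdivrMr //; nra.
have [sg|gs] := ltP s g; first by rewrite lamL 1?ltW //; apply: cl; rewrite s0.
rewrite lamR //; apply: osc; first by apply/andP; split; nra.
by rewrite gridfloor_ge // gridfloor_lt_gridceil.
Qed.

(** The classical partition of a cadlag path into intervals of small oscillation, run as a supremum
    argument with the gluing built in: [E] collects the endpoints reachable for all large [n], its
    supremum is reached, and it cannot be less than [T]. *)
Lemma near_grid_changeT w e : 0 < e -> \forall n \near \oo, exists lam, grid_change w e n T lam.
Proof.
move=> e0; have e2 : 0 < e / 2 by rewrite divr_gt0.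
pose E := [set b | 0 <= b <= T /\ \forall n \near \oo, exists lam, grid_change w e n b lam].
have E0 : E 0.
  split; first by rewrite lexx ltW.
  by near=> n; exists id; exact: grid_change0.
have extend b b' : E b -> b < b' <= T ->
    (forall x y, b <= x < b' -> b <= y < b' -> close e (w x) (w y)) -> E b'.
  move=> [/andP[b0 bT] hb] /andP[bb' b'T] osc; split; first by rewrite b'T andbT; lra.
  near=> n; have [lam hlam] : exists lam, grid_change w e n b lam by near: n; exact: hb.
  apply: (grid_change_step _ _ _ _ _ _ bb' _ b0 osc hlam).
  by near: n; apply: mesh_near; rewrite subr_gt0.
have supE : has_sup E.
  by split; [exists 0|exists T => b [/andP[]]].
pose c := sup E.
have c0 : 0 <= c by apply: ub_le_sup => //; exact: (proj2 supE).
have cT : c <= T by apply: ge_sup; [exists 0|move=> b [/andP[]]].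
have Ec : E c.
  have [c00|cN0] := eqVneq c 0; first by rewrite c00.
  have cgt0 : 0 < c by rewrite lt_def cN0.
  (* Just before [c] the path stays within [e / 2] of its left limit, so one step from a nearby
     element of [E] reaches [c]. The oscillation condition excludes the right endpoint, hence a jump
     at [c] does no harm. *)
  have [l /cvg_closeP /(_ _ e2)] := pth_left T_gt0 w c.
  move=> /nbhs_ballP[r /= r0 hr].
  have [b Eb cb] := sup_adherent r0 supE.
  have bc : b <= c by apply: ub_le_sup => //; exact: (proj2 supE).
  have [<- //|bc'] := eqVneq b c.
  apply: (extend b) => //; first by rewrite cT andbT lt_neqAle bc'.
  have hl x : b <= x < c -> close (e / 2) l (w x).
    move=> /andP[bx xc]; apply: hr => //=.
    by rewrite -/c in cb; rewrite /ball /= ger0_norm; lra.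
  move=> x y hx hy; rewrite (splitr e).
  by apply: close_trans (hl _ hy); exact: closeC (hl _ hx).
have [<-|cNT] := eqVneq c T; first exact: (proj2 Ec).
have cltT : c < T by rewrite lt_neqAle cNT.
(* Right continuity allows a further step beyond [c], contradicting that [c] is an upper bound. *)
have /cvg_closeP /(_ _ e2) /nbhs_ballP[r /= r0 hr] := pth_right T_gt0 w c.
pose b := Num.min (c + r / 2) T.
have cb : c < b by rewrite lt_min cltT andbT; lra.
suff /(ub_le_sup (proj2 supE)) : E b by rewrite -/c leNgt cb.
apply: (extend c) => //; first by rewrite cb ge_min lexx orbT.
have hc x : c <= x < b -> close (e / 2) (w c) (w x).
  move=> /andP[]; rewrite le_eqVlt => /predU1P[<- _ i|cx].
    by rewrite subrr normr0.
  rewrite lt_min => /andP[xc _]; apply: hr => //=.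
  by rewrite /ball /= ltr0_norm; lra.
move=> x y hx hy; rewrite (splitr e).
by apply: close_trans (hc _ hy); exact: closeC (hc _ hx).
Unshelve. all: by end_near. Qed.

Lemma grid_change_time_change w e n lam : grid_change w e n T lam -> time_changes R T lam.
Proof.
move=> [clam mlam lam0]; rewrite gridceilT => lamT _; split.
  exact: continuous_subspaceT.
split=> [x y _ _|]; first exact: mlam.
apply/seteqP; split => [_ [s /andP[s0 sT] <-]|s /andP[s0 sT]].
  have mono := le_mono mlam.
  by rewrite /= -lam0 -lamT !mono s0.
have [||c] := @IVT _ lam 0 T s (ltW T_gt0).
- exact: continuous_subspaceT.
- by rewrite lam0 lamT min_l ?(ltW T_gt0) // max_r ?s0 // ltW.
by rewrite in_itv /= => hc <-; exists c.
Qed.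

(** A grid change with tolerance 1 puts every value before [T] within 1, coordinatewise, of one of
    finitely many grid values; surjectivity of the time change ensures that all times are
    covered. *)
Lemma pth_bounded w : exists M : R, forall s, eucl (w s) <= M.
Proof.
have [n _ hn] := near_grid_changeT w 1 ltr01.
have [lam hlam] := hn n (leqnn n).
have [_ [_ surj]] := grid_change_time_change _ _ _ _ hlam.
have [_ _ _ lamT [_ cl]] := hlam; rewrite gridceilT in cl lamT.
pose M := 1 + \sum_(k < n.+1) eucl (w (mesh n * k%:R)) + eucl (w T).
exists (d%:R * M) => s; rewrite -pth_clampT; apply: eucl_le => i.
have : [set s | 0 <= s <= T] (clampT T s) by exact: (clampT_itv T_gt0).
rewrite -{1}surj => -[u /andP[u0 uT] <-].
have S0 : 0 <= \sum_(k < n.+1) eucl (w (mesh n * k%:R)).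
  by apply: sumr_ge0 => k _; exact: eucl_ge0.
move: uT; rewrite le_eqVlt => /predU1P[->|uT].
  rewrite lamT (le_trans (coord_le_eucl _ _)) // /M; lra.
have /(cl u) /(_ i) : 0 <= u < T by rewrite u0.
rewrite /gridfloor; set k := Num.floor _ => cli.
have k0 : 0 <= k by rewrite floor_ge0 divr_ge0 // ltW // mesh_gt0.
have kn : k < n.+1%:Z.
  rewrite floor_lt_int ltr_pdivrMr ?mesh_gt0 // /mesh mulrC divfK //.
move: k0 kn cli; case: k => // k _; rewrite ltz_nat => kn cli.
have : eucl (w (mesh n * k%:R)) <= \sum_(k < n.+1) eucl (w (mesh n * k%:R)).
  rewrite (bigD1 (Ordinal kn)) //= lerDl sumr_ge0 // => j _; exact: eucl_ge0.
have := coord_le_eucl (w (mesh n * k%:R)) i.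
have := eucl_ge0 (w T); move: cli; rewrite /M.
have := ler_normD (w (lam u) ord0 i - w (mesh n * k%:R) ord0 i) (w (mesh n * k%:R) ord0 i).
rewrite subrK; lra.
Qed.

End Grid.

(** * Supremum norm and bounds on the Skorohod distance *)

Section SupremumNorm.
Context {R : realType} {T : R} {d : nat} (T_gt0 : 0 < T).
Local Notation path := (cpath R T d).
Local Notation supn := (supn R T d).
Local Notation dSK := (dSK R T d).
Implicit Types (w : path) (s e : R) (n : nat).

Lemma eucl_le_supn w s : eucl (w s) <= supn w.
Proof.
have [M hM] := pth_bounded T_gt0 w.
rewrite -pth_clampT; apply: ub_le_sup; first by exists M => _ [u _ <-].
by exists (clampT T s) => //; exact: (clampT_itv T_gt0).
Qed.

Lemma supn_le w e : (forall s, 0 <= s <= T -> eucl (w s) <= e) -> supn w <= e.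
Proof.
move=> h; apply: ge_sup; first by exists (eucl (w 0)), 0; rewrite //= lexx ltW.
by move=> _ [s hs <-]; exact: h.
Qed.

Lemma supn_ge0 w : 0 <= supn w.
Proof. exact: le_trans (eucl_ge0 (w 0)) (eucl_le_supn w 0). Qed.

Lemma time_changes_id : time_changes R T id.
Proof.
split; first by apply: continuous_subspaceT => s; exact: cvg_id.
by split=> //; rewrite image_id.
Qed.

Lemma SK_cost_ge0 w w' (lam : R -> R) :
  0 <= sup [set `|s - lam s| + eucl (w s - w' (lam s)) | s in [set s | 0 <= s <= T]].
Proof.
(* A set without finite supremum has [sup] equal to 0, which also satisfies the claim. *)
set S := [set _ | _ in _]; have [hS|/sup_out -> //] := pselect (has_sup S).
apply: (@le_trans _ _ (`|0 - lam 0| + eucl (w 0 - w' (lam 0)))).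
  by rewrite addr_ge0 // eucl_ge0.
apply: ub_le_sup; first exact: (proj2 hS).
by exists 0; rewrite //= lexx ltW.
Qed.

Lemma dSK_ge0 w w' : 0 <= dSK w w'.
Proof.
apply: lb_le_inf; last by move=> _ [lam _ <-]; exact: SK_cost_ge0.
by eexists; exists id; [exact: time_changes_id|].
Qed.

Lemma dSK_le w w' (lam : R -> R) e : time_changes R T lam ->
  (forall s, 0 <= s <= T -> `|s - lam s| + eucl (w s - w' (lam s)) <= e) ->
  dSK w w' <= e.
Proof.
move=> hlam h; apply: (@le_trans _ _
  (sup [set `|s - lam s| + eucl (w s - w' (lam s)) | s in [set s | 0 <= s <= T]])).
  apply: ge_inf; last by exists lam.
  by exists 0 => _ [? _ <-]; exact: SK_cost_ge0.
apply: ge_sup; last by move=> _ [s hs <-]; exact: h.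
by eexists; exists 0; [rewrite /= lexx ltW|].
Qed.

Lemma dSK_le_supn w w' : dSK w w' <= 2 * (supn w + supn w').
Proof.
apply: (dSK_le _ _ id); first exact: time_changes_id.
move=> s _; rewrite subrr normr0 add0r (le_trans (eucl_leD _ _)) // euclN.
by rewrite ler_pM2l // lerD // eucl_le_supn.
Qed.

Lemma dSKxx w : dSK w w = 0.
Proof.
apply/eqP; rewrite eq_le dSK_ge0 andbT.
apply: (dSK_le _ _ id); first exact: time_changes_id.
by move=> s _; rewrite !subrr normr0 eucl0 addr0.
Qed.

End SupremumNorm.

(** * Countably valued approximations of a path *)

Section Discretization.
Context {R : realType} {T : R} {d : nat} (T_gt0 : 0 < T).
Local Notation path := (cpath R T d).
Local Notation mesh := (@mesh R T).
Local Notation gridfloor := (@gridfloor R T).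
Implicit Types (w : path) (s e : R) (n : nat).

(** The [n.+2] rows are the grid times from 0 to [T] inclusive, and values are rounded down to
    multiples of [1 / n.+1]. Integer entries make the type of codes countable. *)
Definition encode n w : 'M[int]_(n.+2, d) :=
  \matrix_(k, i) Num.floor (w (mesh n * (k : nat)%:R) ord0 i * n.+1%:R).

(** For [s] in [[0, T]] the truncated quotient is at most [n.+1], so [inord] does not fall back to
    its default; the last row is read only at [s = T]. *)
Definition decode_fun n (c : 'M[int]_(n.+2, d)) s : 'rV[R]_d :=
  \row_i ((c (inord (Num.trunc (s / mesh n))) i)%:~R / n.+1%:R).

Definition decode n (c : 'M[int]_(n.+2, d)) : path := mkpath R T d (decode_fun n c).

Definition discretize n w : path := decode n (encode n w).

Lemma trunc_mesh_right n s : 0 <= s ->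
  \forall x \near s^'+, Num.trunc (x / mesh n) = Num.trunc (s / mesh n).
Proof.
move=> s0; have m0 := mesh_gt0 T_gt0 n.
have /truncn_itv/andP[h1 h2] : 0 <= s / mesh n by rewrite divr_ge0 // ltW.
near=> x; apply: truncn_def; apply/andP; split.
  apply: le_trans h1 _; rewrite ler_pM2r ?invr_gt0 //.
rewrite ltr_pdivrMr //; near: x; apply: nbhs_right_lt.
by rewrite -ltr_pdivrMr.
Unshelve. all: by end_near. Qed.

Lemma trunc_mesh_left n s : 0 < s ->
  exists k, \forall x \near s^'-, Num.trunc (x / mesh n) = k.
Proof.
move=> s0; have m0 := mesh_gt0 T_gt0 n.
have /truncn_itv/andP[h1 h2] : 0 <= s / mesh n by rewrite divr_ge0 // ltW.
set m := Num.trunc _ in h1 h2.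
(* Just to the left of [s] the quotient has integer part [m], except at a grid time, where it is
   [m - 1]. *)
suff [k /andP[h3 h4]] : exists k : nat, k%:R < s / mesh n <= k.+1%:R.
  exists k; near=> x; apply: truncn_def; apply/andP; split.
    rewrite ler_pdivlMr //; apply: ltW; near: x; apply: nbhs_left_gt.
    by rewrite -ltr_pdivlMr.
  apply: lt_le_trans h4; rewrite ltr_pM2r ?invr_gt0 //.
move: h1; rewrite le_eqVlt => /predU1P[ms|h1]; last by exists m; rewrite h1 ltW.
have : 0 < s / mesh n by rewrite divr_gt0.
rewrite -ms ltr0n => m_gt0; exists m.-1.
by rewrite prednK // lexx ltr_nat prednK // leqnn.
Unshelve. all: by end_near. Qed.

Lemma decode_fun_cadlag n c : is_cadlag T (decode_fun n c).
Proof.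
split=> s /andP[s0 sT].
  apply/cvg_closeP => e e0; apply: filterS (trunc_mesh_right n s s0) => x xs i.
  by rewrite /decode_fun xs subrr normr0.
have [k hk] := trunc_mesh_left n s s0.
exists (\row_i ((c (inord k) i)%:~R / n.+1%:R)); apply/cvg_closeP => e e0.
by apply: filterS hk => x xk i; rewrite /decode_fun xk subrr normr0.
Qed.

Lemma decodeE n c s : 0 <= s <= T -> decode n c s = decode_fun n c s.
Proof.
move=> sT; rewrite /decode (mkpathE T_gt0); last exact: decode_fun_cadlag.
by rewrite /ext clampT_id.
Qed.

Lemma discretizeE n w s i : 0 <= s <= T ->
  discretize n w s ord0 i = (Num.floor (w (gridfloor n s) ord0 i * n.+1%:R))%:~R / n.+1%:R.
Proof.
move=> /andP[s0 sT]; have m0 := mesh_gt0 T_gt0 n.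
have q0 : 0 <= s / mesh n by apply: divr_ge0 => //; exact: ltW.
rewrite /discretize decodeE ?s0 // /decode_fun /encode !mxE inordK; last first.
  rewrite truncn_lt_nat // ltr_pdivrMr //.
  apply: (le_lt_trans sT); rewrite /mesh mulrCA -[ltLHS]mulr1 ltr_pM2l //.
  by rewrite ltr_pdivlMr // mul1r ltr_nat.
rewrite /gridfloor truncn_floor q0 natr_absz.
by rewrite ger0_norm // floor_ge0.
Qed.

Lemma discretize_close n w s : 0 <= s <= T ->
  close (2 / n.+1%:R) (discretize n w s) (w (gridfloor n s)).
Proof.
move=> sT i; rewrite discretizeE //.
set y := w _ _ _; set m : R := n.+1%:R.
have m0 : 0 < m by rewrite ltr0n.
have /andP[h1 h2] := floor_itv (y * m).
rewrite rmorphD /= in h2; set z := (Num.floor _)%:~R in h1 h2 *.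
rewrite (_ : z / m - y = (z - y * m) / m); last by field; rewrite gt_eqF.
rewrite normrM (gtr0_norm (_ : 0 < m^-1)) ?invr_gt0 // ltr_pM2r ?invr_gt0 //.
rewrite ltr_norml; apply/andP; split; lra.
Qed.

Lemma supn_discretize n w : supn R T d (discretize n w) <= 2 * (2 * d%:R + supn R T d w).
Proof.
apply: (supn_le T_gt0) => s sT.
rewrite -[discretize n w s](subrK (w (gridfloor n s))) (le_trans (eucl_leD _ _)) //.
rewrite ler_pM2l // lerD ?(eucl_le_supn T_gt0) //.
apply: le_trans (close_eucl _ _ _ (discretize_close n w s sT)) _.
rewrite mulrC ler_wpM2r // ler_pdivrMr // ler_peMr // ler1n //.
Qed.

Lemma dSK_discretize_cvg w : dSK R T d (discretize n w) w @[n --> \oo] --> (0 : R).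
Proof.
(* Half of [e] pays for the displacement in time; the other half is [d.+1 * (r + r)], one [r] for
   rounding and one for the oscillation. Using [d.+1] keeps the denominator positive. *)
apply/cvgrPdist_le => e e0; pose r := e / (2 * d.+1%:R) / 2.
have r0 : 0 < r by rewrite !divr_gt0.
have r20 : 0 < r / 2 by rewrite divr_gt0.
near=> n; rewrite sub0r normrN ger0_norm ?(dSK_ge0 T_gt0) //.
have [lam hlam] : exists lam, grid_change w r n T lam.
  by near: n; exact: near_grid_changeT.
have h1 : mesh n < e / 2 by near: n; apply: mesh_near => //; rewrite divr_gt0.
have h2 : n.+1%:R^-1 < r / 2 by near: n; exact: (near_infty_natSinv_lt (PosNum r20)).
apply: (dSK_le T_gt0 _ _ lam); first exact: (grid_change_time_change T_gt0 _ _ _ _ hlam).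
move=> s sT; have [_ _ _ lamT [near_id cl]] := hlam.
rewrite gridceilT // in lamT near_id cl.
have -> : e = e / 2 + d.+1%:R * (r + r).
  have : d.+1%:R != 0 :> R by rewrite pnatr_eq0.
  by rewrite /r; move: (d.+1%:R : R) => D D0; field.
apply: lerD; first by apply: le_trans (near_id s sT) _; exact: ltW.
apply: (@le_trans _ _ (d%:R * (r + r))); last first.
  by rewrite ler_pM2r ?ler_nat // addr_gt0.
have h3 : close r (discretize n w s) (w (gridfloor n s)).
  move=> i; apply: lt_trans (discretize_close n w s sT i) _.
  by rewrite mulrC -ltr_pdivlMr.
apply: close_eucl; apply: close_trans h3 _.
(* The oscillation bound of a grid change holds only before its final time, so [s = T] is treated
   apart: there [gridfloor] and [lam] both return [T]. *)
move: sT => /andP[s0]; rewrite le_eqVlt => /predU1P[->|sT]; last first.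
  by apply: closeC; apply: cl; rewrite s0.
have -> : gridfloor n T = T.
  apply/eqP; rewrite eq_le gridfloor_le //= gridfloor_ge // gridceilT //.
by rewrite lamT => i; rewrite subrr normr0.
Unshelve. all: by end_near. Qed.

End Discretization.

(** * Measurability *)

Lemma preimage_smallest_sigma_algebra (disp : measure_display) (U : measurableType disp)
  (V : Type) (G : set (set V)) (Y : U -> V) :
  (forall A, G A -> measurable (Y @^-1` A)) ->
  forall A, <<s G >> A -> measurable (Y @^-1` A).
Proof.
move=> h; apply: (@smallest_sub _ (sigma_algebra setT) G [set A | measurable (Y @^-1` A)]) => //.
split=> [|A mA|F mF] /=.
- by rewrite preimage_set0.
- by rewrite setTD preimage_setC; exact: measurableC.
- by rewrite preimage_bigcup; exact: bigcupT_measurable.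
Qed.

(** Since [S] is arbitrary, functions on a countable type of codes obtained by choice yield
    measurable functions of the path. *)
Lemma measurable_countable_fibers (disp : measure_display) (U : measurableType disp)
  (C : countType) (q : U -> C) (S : set C) :
  (forall c, measurable (q @^-1` [set c])) -> measurable (q @^-1` S).
Proof.
move=> h; rewrite (_ : q @^-1` S = \bigcup_c ((q @^-1` [set c]) `&` [set _ | S c])).
  apply: countable_bigcupT_measurable => [|c]; first exact: countableP.
  have [Sc|Sc] := pselect (S c).
    by rewrite (_ : [set _ | _] = setT) ?setIT // -subTset.
  by rewrite (_ : [set _ | _] = set0) ?setI0 // -subset0.
by apply/seteqP; split => [w Sw|w [c _ [/= <-]]] //; exists (q w).
Qed.

(** * Borel measurability of vectors through coordinates *)

Section VectorMeasurability.
Context {R : realType} {d : nat} {disp : measure_display} {U : measurableType disp}.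
Implicit Types Y : U -> 'rV[R]_d.

Definition vmeasurable Y := forall i, measurable_fun setT (fun w => Y w ord0 i).

Lemma vmeasurableP Y :
  (forall B, borelRd R d B -> measurable (Y @^-1` B)) <-> vmeasurable Y.
Proof.
split=> [h i|mY].
  apply: (measurability _ (RGenOInfty.measurableE R)) => //.
  move=> /= _ [_ [a ->] <-]; rewrite setTI preimage_itvoy.
  apply: (h [set v : 'rV[R]_d | a < v ord0 i]).
  apply: sub_sigma_algebra => /=.
  exact: (open_comp (fun x _ => @coord_continuous _ _ _ _ _ x) (@open_gt R a)).
apply: preimage_smallest_sigma_algebra => B /= oB.
pose box (p : 'rV[rat]_d * nat) :=
  [set v : 'rV[R]_d | close p.2.+1%:R^-1 v (map_mx ratr p.1)].
pose good p := box p `<=` B.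
(* An open set is the countable union of the boxes with rational center and radius [1 / k.+1] that
   it contains. The factor [[set _ | good p]], which is everything or nothing, discards the other
   boxes. *)
have -> : Y @^-1` B = \bigcup_p ((Y @^-1` box p) `&` [set _ | good p]).
  apply/seteqP; split => [w Bw|w [p _ [/= hw]]]; last exact.
  have /nbhs_ballP[e /= e0 he] : nbhs (Y w) B by apply: open_nbhs_nbhs.
  have [k _ /(_ _ (leqnn k)) /= hk] := near_infty_natSinv_lt (PosNum (divr_gt0 e0 (ltr0n _ 2))).
  have hc i : {c : rat | `|Y w ord0 i - ratr c| < k.+1%:R^-1}.
    apply: cid; have [|c] := @rat_in_itvoo R (Y w ord0 i - k.+1%:R^-1) (Y w ord0 i + k.+1%:R^-1).
      by rewrite ltrD2l gtrN // invr_gt0.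
    rewrite in_itv /= => /andP[h1 h2]; exists c.
    by move: h1 h2; set z := _^-1; rewrite ltr_norml => h1 h2; apply/andP; split; lra.
  exists (\row_i sval (hc i), k) => //; split => [i|].
    by rewrite !mxE; exact: svalP (hc i).
  move=> v hv; apply: he; apply/(ball_close _ _ _ e0).
  have hw : close k.+1%:R^-1 (Y w) (map_mx ratr (\row_i sval (hc i))).
    by move=> i; rewrite !mxE; exact: svalP (hc i).
  move=> i; apply: lt_trans (close_trans _ _ _ _ _ hw (closeC _ _ _ hv) i) _.
  by rewrite (splitr e) ltrD.
apply: countable_bigcupT_measurable => [|p]; first exact: countableP.
have [gp|gp] := pselect (good p); last first.
  by rewrite (_ : [set _ | _] = set0) ?setI0 // -subset0.
rewrite (_ : [set _ | _] = setT) ?setIT; last by rewrite -subTset.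
rewrite (_ : _ @^-1` _ = \bigcap_(i in [set: 'I_d])
   [set w | `|Y w ord0 i - ratr (p.1 ord0 i)| < p.2.+1%:R^-1]); last first.
  by apply/seteqP; split => w h i => [_|]; have := h i; rewrite /= !mxE //; apply.
apply: fin_bigcap_measurable => [|i _]; first exact: finite_finset.
rewrite -[X in measurable X]setTI.
have m1 : measurable_fun setT (fun w => `|Y w ord0 i - ratr (p.1 ord0 i)|).
  by apply: measurableT_comp => //; apply: measurable_funB.
rewrite -preimage_itvNyo; exact: m1.
Qed.

Lemma vmeasurable_comp {disp' : measure_display} {V : measurableType disp'}
    (h : V -> U) Y : measurable_fun setT h -> vmeasurable Y ->
  forall i, measurable_fun setT (fun w => Y (h w) ord0 i).
Proof. by move=> mh mY i; exact: (measurableT_comp (mY i) mh). Qed.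

Lemma vmeasurableB Y Y' : vmeasurable Y -> vmeasurable Y' -> vmeasurable (fun w => Y w - Y' w).
Proof.
move=> m1 m2 i; rewrite (_ : (fun _ => _) = (fun w => Y w ord0 i - Y' w ord0 i)).
  exact: measurable_funB.
by apply/funext => w; rewrite !mxE.
Qed.

Lemma vmeasurableZ (c : R) Y : vmeasurable Y -> vmeasurable (fun w => c *: Y w).
Proof.
move=> m1 i; rewrite (_ : (fun _ => _) = (fun w => c * Y w ord0 i)).
  exact: measurable_funM.
by apply/funext => w; rewrite !mxE.
Qed.

Lemma measurable_eucl Y : vmeasurable Y -> measurable_fun setT (fun w => eucl (Y w)).
Proof.
move=> mY; apply: (@measurableT_comp _ _ _ _ _ _ (@Num.sqrt R)).
  by apply: continuous_measurable_fun; exact: sqrt_continuous.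
by apply: measurable_sum => i; exact: measurable_funX.
Qed.

Lemma measurable_eucl_sqr Y : vmeasurable Y ->
  measurable_fun setT (fun w => (eucl (Y w) ^+ 2)%:E).
Proof. by move=> mY; apply/measurable_EFinP/measurable_funX/measurable_eucl. Qed.

Lemma measurable_dotv Y Y' : vmeasurable Y -> vmeasurable Y' ->
  measurable_fun setT (fun w => dotv (Y w) (Y' w)).
Proof. by move=> mY mY'; apply: measurable_sum => i; exact: measurable_funM. Qed.

End VectorMeasurability.

Lemma cvg_eucl {R : realType} {d : nat} {V : Type} (F : set_system V) {FF : Filter F}
    (g : V -> 'rV[R]_d) (x : 'rV[R]_d) :
  g @ F --> x -> eucl (g u) @[u --> F] --> eucl x.
Proof.
move=> h; apply: (@cvg_comp _ _ _ (fun u => \sum_(i < d) g u ord0 i ^+ 2) (@Num.sqrt R));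
  last exact: sqrt_continuous.
apply: cvg_big => [|i _]; first exact: (@add_continuous R^o).
apply: (@cvg_comp _ _ _ (fun u => g u ord0 i) (fun y : R => y ^+ 2)); last exact: exprn_continuous.
exact: (cvg_comp g (fun v : 'rV[R]_d => v ord0 i) h (@coord_continuous R 1 d ord0 i x)).
Qed.

Lemma near_rat_right {R : realType} (g : R -> R) s a :
  g x @[x --> s^'+] --> g s -> a < g s -> exists q : rat, a < g (ratr q).
Proof.
move=> gs ags; have : \forall x \near s^'+, a < g x by exact: (cvgr_gt _ gs).
move=> /nbhs_ballP[r /= r0 hr].
have [|q] := @rat_in_itvoo R s (s + r); first by rewrite ltrDl.
rewrite in_itv /= => /andP[h1 h2]; exists q; apply: hr => //=.
by rewrite /ball /= ltr0_norm; lra.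
Qed.

(** * Measurability of operations on random paths *)

Section PathMeasurability.
Context {R : realType} {T : R} {d : nat} (T_gt0 : 0 < T).
Context {disp : measure_display} {U : measurableType disp}.
Local Notation Om := (Omhat R T d).
Local Notation Omu u := (g_sigma_algebraType (coordG R T d u)).

Lemma measurable_pathP (u : R) (X : U -> Omu u) :
  measurable_fun setT X <->
  forall s, 0 <= s <= u -> vmeasurable (fun w => (X w : cpath R T d) s).
Proof.
split=> [mX s su|h].
  apply/vmeasurableP => B bB; rewrite -[X in measurable X]setTI.
  apply: (mX measurableT [set x : Omu u | B ((x : cpath R T d) s)]).
  by apply: sub_sigma_algebra; exists s, B.
move=> _ A mA; rewrite setTI.
apply: (preimage_smallest_sigma_algebra disp U _ (coordG R T d u) X) => // _ [s [B [su [bB ->]]]].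
rewrite -comp_preimage; have /vmeasurableP := h s su; exact.
Qed.

Lemma measurable_pth (X : U -> Om) s : measurable_fun setT X ->
  vmeasurable (fun w => (X w : cpath R T d) s).
Proof.
move=> /measurable_pathP mX; have := mX _ (clampT_itv T_gt0 s).
by rewrite (_ : (fun _ => _) = (fun w => (X w : cpath R T d) s)) //;
   apply/funext => w; rewrite pth_clampT.
Qed.

Lemma measurable_supn (X : U -> Om) : measurable_fun setT X ->
  measurable_fun setT (fun w => supn R T d (X w)).
Proof.
move=> mX; apply: (measurability _ (RGenOInfty.measurableE R)) => //.
move=> /= _ [_ [a ->] <-]; rewrite setTI preimage_itvoy.
(* By right continuity rational times detect that the supremum exceeds [a]. All rationals may be
   used, since values outside [[0, T]] repeat those at the endpoints. *)
rewrite [X in measurable X](_ : _ =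
    \bigcup_(q : rat) [set w | a < eucl ((X w : cpath R T d) (ratr q))]).
  apply: bigcupT_measurable_rat => q; rewrite -preimage_itvoy -[X in measurable X]setTI.
  exact: (measurable_eucl _ (measurable_pth X _ mX)).
apply/seteqP; split => w /=; last first.
  by move=> [q _ /= h]; apply: lt_le_trans h _; exact: (eucl_le_supn T_gt0).
move=> h; apply: contrapT => hN; move: h; apply/negP; rewrite -leNgt.
apply: (supn_le T_gt0) => s _; rewrite leNgt; apply/negP => as_.
have [||q] := near_rat_right (fun x => eucl ((X w : cpath R T d) x)) s a; first last.
- by move=> aq; apply: hN; exists q.
- exact: as_.
apply: cvg_eucl; exact: (pth_right T_gt0).
Qed.

Lemma measurable_supn_sqr (X : U -> Om) : measurable_fun setT X ->
  measurable_fun setT (fun w => (supn R T d (X w) ^+ 2)%:E).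
Proof. by move=> mX; apply/measurable_EFinP/measurable_funX/measurable_supn. Qed.

(** The source carries the sigma-algebra at time [t] and the target the one at [T]: stopping turns
    measurable functions of the whole path into functions measurable at time [t]. *)
Lemma measurable_stop t (X : U -> Omu t) : 0 <= t <= T -> measurable_fun setT X ->
  measurable_fun setT (fun w => stop R T d t (X w) : Om).
Proof.
move=> tT mX; apply/measurable_pathP => s /andP[s0 sT] i.
rewrite (_ : (fun _ => _) = (fun w => (X w : cpath R T d) (Num.min s t) ord0 i)).
  have /measurable_pathP := mX; apply.
  by rewrite le_min s0 (andP tT).1 ge_min lexx orbT.
by apply/funext => w; rewrite stopE.
Qed.

Lemma measurable_coordG_le (u v : R) (X : U -> Omu v) : u <= v ->
  measurable_fun setT X -> measurable_fun setT (X : U -> Omu u).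
Proof.
move=> uv /measurable_pathP mX; apply/measurable_pathP => s /andP[s0 su].
by apply: mX; rewrite s0 (le_trans su).
Qed.

Lemma measurable_shiftp t (X : U -> Om) (xi : U -> 'rV[R]_d) :
  measurable_fun setT X -> vmeasurable xi ->
  measurable_fun setT (fun w => shiftp R T d t (X w) (xi w) : Om).
Proof.
move=> mX mxi; apply/measurable_pathP => s sT i.
rewrite (_ : (fun _ => _) = (fun w => (X w : cpath R T d) s ord0 i +
   if t <= clampT T s then xi w ord0 i else 0)).
  apply: measurable_funD; first exact: measurable_pth.
  by case: (t <= clampT T s); [exact: mxi|exact: measurable_cst].
by apply/funext => w; rewrite shiftpE // mxE; case: ifP; rewrite // mxE.
Qed.

Lemma measurable_encode n (X : U -> Om) : measurable_fun setT X ->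
  forall c, measurable ((fun w => encode n (X w)) @^-1` [set c]).
Proof.
move=> mX c; rewrite [X in measurable X](_ : _ = \bigcap_(p in [set: 'I_n.+2 * 'I_d])
  [set w | Num.floor ((X w : cpath R T d) (@mesh R T n * (p.1 : nat)%:R) ord0 p.2 * n.+1%:R) = c p.1 p.2]);
  last first.
  apply/seteqP; split => [w /= <- p _|w h] /=; first by rewrite mxE.
  by apply/matrixP => k i; rewrite mxE; exact: (h (k, i)).
apply: fin_bigcap_measurable => [|p _]; first exact: finite_finset.
pose y w := (X w : cpath R T d) (@mesh R T n * (p.1 : nat)%:R) ord0 p.2 * n.+1%:R.
have my : measurable_fun setT y by apply: measurable_funM => //; exact: measurable_pth.
rewrite [X in measurable X](_ : _ = setT `&`
  y @^-1` `[(c p.1 p.2)%:~R, (c p.1 p.2 + 1)%:~R[%classic).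
  exact: my.
apply/seteqP; split => w /=.
  by move=> <-; split => //; rewrite in_itv /= floor_itv.
by move=> [_]; rewrite in_itv /= => /floor_def.
Qed.

Lemma measurable_discretize n (X : U -> Om) : measurable_fun setT X ->
  measurable_fun setT (fun w => discretize n (X w) : Om).
Proof.
move=> mX _ A _; rewrite setTI.
apply: (measurable_countable_fibers _ _ _ (fun w => encode n (X w)) (@decode R T d n @^-1` A)).
exact: measurable_encode.
Qed.

End PathMeasurability.

(** The generating events look at times up to [t], where stopping changes nothing. This lets null
    sets for the stopped path be read under the law of the path itself. *)
Lemma stop_preimage {R : realType} {T : R} {d : nat} (T_gt0 : 0 < T) (t : R)
    (A : set (cpath R T d)) : 0 <= t <= T -> Fhat R T d t A ->
  stop R T d t @^-1` A = A.
Proof.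
move=> tT; apply: (@smallest_sub _ (sigma_algebra setT) (coordG R T d t)
   [set A | stop R T d t @^-1` A = A]).
  split=> [|B hB|F hF] /=; first exact: preimage_set0.
    by rewrite setTD -[in RHS]hB preimage_setC.
  by rewrite preimage_bigcup; apply: eq_bigcupr => n _; exact: hF.
move=> _ [s [B [/andP[s0 st] [_ ->]]]] /=.
by apply/seteqP; split => w /=; rewrite stopE // min_l.
Qed.

Lemma Fhat_le {R : realType} {T : R} {d : nat} (u v : R) : u <= v ->
  Fhat R T d u `<=` Fhat R T d v.
Proof.
move=> uv; apply: sub_sigma_algebra2 => _ [s [B [/andP[s0 su] [bB ->]]]].
by exists s, B; rewrite s0 (le_trans su).
Qed.

Lemma FmeasP {R : realType} {T : R} {d : nat} (u : R) (psi : cpath R T d -> 'rV[R]_d) :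
  Fmeas R T d u psi <->
  @vmeasurable R d _ (g_sigma_algebraType (coordG R T d u)) psi.
Proof.
split=> [h|/vmeasurableP h B]; last exact: h.
by apply/vmeasurableP => B; exact: h.
Qed.

(** * Lower integrals and atomless measures *)

Section LowerIntegral.
Import HBNNSimple.

(* Off measurable functions the library integral of a nonnegative function is its
   lower integral, so no measurability of the Skorohod distance is needed. *)
Lemma dominated_lower_cvg0 {R : realType} {disp : measure_display} {U : measurableType disp}
    (P : {measure set U -> \bar R}) (h : nat -> U -> R) (G : U -> R) :
  (forall n w, 0 <= h n w <= G w) -> measurable_fun setT G ->
  (\int[P]_w (G w)%:E < +oo)%E -> (forall w, h n w @[n --> \oo] --> (0 : R)) ->
  (\int[P]_w (h n w)%:E)%E @[n --> \oo] --> 0%E.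
Proof.
move=> hG mG iG hcvg.
have h0 n w : 0 <= h n w by have /andP[] := hG n w.
have hle n w : h n w <= G w by have /andP[] := hG n w.
have G0 w : 0 <= G w by exact: le_trans (h0 0%N w) (hle 0%N w).
have iG' : P.-integrable setT (EFin \o G).
  apply/integrableP; split; first exact/measurable_EFinP.
  by under eq_integral do rewrite /= ger0_norm //.
(* A simple function below [h n] whose integral is within [1 / n.+1] of the supremum is measurable
   and still dominated by [G], so ordinary dominated convergence applies to these minorants. *)
have approx n : exists phi : {nnsfun U >-> R}, (forall w, phi w <= h n w) /\
    (\int[P]_w (h n w)%:E <= \int[P]_w (phi w)%:E + (n.+1%:R^-1)%:E)%E.
  pose S := [set sintegral P g | g in [set g : {nnsfun U >-> R} | forall w, ((g w)%:E <= (h n w)%:E)%E]].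
  have SE : (\int[P]_w (h n w)%:E)%E = ereal_sup S.
    by rewrite ge0_integralTE // => w; rewrite lee_fin.
  have Sfin : ereal_sup S \is a fin_num.
    rewrite ge0_fin_numE; last by rewrite -SE integral_ge0 // => w _; rewrite lee_fin.
    apply: le_lt_trans iG; apply: ge_ereal_sup => _ [g /= gh <-].
    rewrite -[sintegral P g](_ : (\int[P]_w (g w)%:E = _)%E); last first.
      by rewrite integral_nnsfun // patch_setT.
    have gG w : ((g w)%:E <= (G w)%:E)%E by apply: le_trans (gh w) _; rewrite lee_fin.
    by apply: ge0_le_integral => //; solve [by move=> w _; rewrite lee_fin
      |exact/measurable_EFinP|by move=> w _; exact: gG].
  have [|_ [g gh <-] hg] := @ub_ereal_sup_adherent _ S n.+1%:R^-1 _ Sfin.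
    by rewrite invr_gt0.
  exists g; split=> [w|]; first by have := gh w; rewrite lee_fin.
  rewrite SE -leeBlDr // ltW // (lt_le_trans hg) //.
  by rewrite integral_nnsfun // patch_setT.
have [phi hphi] := choice approx.
have phi0 n w : 0 <= phi n w by [].
have cv : (\int[P]_w (phi n w)%:E)%E @[n --> \oo] --> 0%E.
  have [||||_ _] := @dominated_convergence _ U R P setT measurableT
    (fun n w => (phi n w)%:E) (fun=> 0%E) (EFin \o G) _ _ _ iG' _.
  - by move=> n; apply/measurable_EFinP.
  - exact: measurable_cst.
  - apply: aeW => w _; apply: cvg_EFin; first exact: nearW.
    apply: (squeeze_cvgr _ (cvg_cst 0) (hcvg w)); apply: nearW => n /=.
    by rewrite phi0 (hphi n).1.
  - apply: aeW => w n _; rewrite /= lee_fin ger0_norm //.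
    exact: le_trans ((hphi n).1 w) (hle n w).
  by rewrite integral0.
apply: (@squeeze_cvge _ _ _ _ (cst 0%E) _
   (fun n => (\int[P]_w (phi n w)%:E + (n.+1%:R^-1)%:E)%E)).
- apply: nearW => n /=; rewrite (hphi n).2 andbT integral_ge0 // => w _.
  by rewrite lee_fin.
- exact: cvg_cst.
rewrite -[X in _ --> X]adde0; apply: cvgeD => //.
apply: cvg_EFin; first exact: nearW.
exact: cvg_harmonic.
Qed.

(** The last clause imposes no measurability on [f]: a nonnegative simple function below [f]
    vanishes on the range of [phi], hence has integral 0. It is used for [dSK] on the diagonal. *)
Lemma image_probability {R : realType} {disp disp' : measure_display}
    {U : measurableType disp} {V : measurableType disp'} (P : probability U R)
    (phi : U -> V) : measurable_fun setT phi ->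
  exists Q : probability V R,
  [/\ forall A, Q A = P (phi @^-1` A),
      forall f : V -> \bar R, measurable_fun setT f -> (forall v, 0 <= f v)%E ->
        (\int[Q]_v f v = \int[P]_w f (phi w))%E &
      forall f : V -> R, (forall v, 0 <= f v) -> (forall w, f (phi w) = 0) ->
        (\int[Q]_v (f v)%:E = 0)%E].
Proof.
move=> mphi.
pose phi' : {mfun U >-> V} := HB.pack phi (isMeasurableFun.Build _ _ _ _ phi mphi).
exists (distribution P phi'); split=> [//|f mf f0|f f0 fphi].
  by rewrite ge0_integral_distribution.
apply/eqP; rewrite eq_le integral_ge0 ?andbT; last by move=> v _; rewrite lee_fin.
rewrite ge0_integralTE; last by move=> v; rewrite lee_fin.
apply: ge_ereal_sup => _ [g /= gf <-].
rewrite -[sintegral _ g](_ : (\int[distribution P phi']_w (g w)%:E = _)%E); last first.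
  by rewrite integral_nnsfun // patch_setT.
rewrite ge0_integral_distribution; last 2 first.
- exact/measurable_EFinP.
- by move=> v; rewrite lee_fin.
rewrite integral0_eq // => w _ /=; apply/eqP; rewrite eq_le lee_fin; apply/andP; split.
  by have := gf (phi w); rewrite fphi.
by rewrite lee_fin.
Qed.

End LowerIntegral.

(** * Intermediate values of an atomless probability *)

Section Sierpinski.
Context {R : realType} {disp : measure_display} {U : measurableType disp}.
Variable P : probability U R.
Local Notation pr A := (fine (P A)).

Lemma prE A : measurable A -> P A = (pr A)%:E.
Proof. by move=> mA; rewrite fineK // fin_num_measure. Qed.

Lemma pr_ge0 A : 0 <= pr A.
Proof. exact: fine_ge0. Qed.

Lemma pr_le A B : measurable A -> measurable B -> A `<=` B -> pr A <= pr B.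
Proof.
by move=> mA mB AB; rewrite -lee_fin -!prE // le_measure ?inE.
Qed.

Lemma prU A B : measurable A -> measurable B -> A `&` B = set0 ->
  pr (A `|` B) = pr A + pr B.
Proof.
move=> mA mB AB; apply: EFin_inj.
by rewrite EFinD -!prE ?measureU //; exact: measurableU.
Qed.

Lemma prD A B : measurable A -> measurable B -> B `<=` A ->
  pr (A `\` B) = pr A - pr B.
Proof.
move=> mA mB BA; have mD := measurableD mA mB.
have := prU B (A `\` B) mB mD; rewrite setDIK setDUK // => /(_ erefl) ->; lra.
Qed.

Hypothesis hP : atomless R P.

(** Of a subset of intermediate probability and its complement, one has at most half the mass;
    iterating the choice gives arbitrarily small positive mass. *)
Lemma atomless_small A (e : R) : measurable A -> 0 < pr A -> 0 < e ->
  exists B, [/\ measurable B, B `<=` A, 0 < pr B & pr B < e].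
Proof.
move=> mA A0 e0.
have half C : measurable C -> 0 < pr C ->
    exists B, [/\ measurable B, B `<=` C, 0 < pr B & pr B <= pr C / 2].
  move=> mC C0; have [|B [mB BC /andP[]]] := hP C mC; first by rewrite prE // lte_fin.
  rewrite (prE B mB) (prE C mC) !lte_fin => B0 BltC; have hD := prD C B mC mB BC.
  have [h|h] := leP (pr B) (pr C / 2); first by exists B.
  exists (C `\` B); split; [exact: measurableD|by move=> w []|lra|lra].
have halves n : exists B, [/\ measurable B, B `<=` A, 0 < pr B & pr B <= pr A / 2 ^+ n].
  elim: n => [|n [B [mB BA B0 hB]]]; first by exists A; split=> //; rewrite expr0 divr1.
  have [C [mC CB C0 hC]] := half B mB B0; exists C; split=> //.
    exact: subset_trans CB BA.
  apply: le_trans hC _; rewrite exprS invfM mulrA mulrAC ler_pM2r ?invr_gt0 //.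
have [n hn] : exists n, pr A / e < n%:R.
  by exists (Num.trunc (pr A / e)).+1; exact: truncnS_gt.
have [B [mB BA B0 hB]] := halves n; exists B; split=> //.
apply: le_lt_trans hB _; rewrite ltr_pdivrMr ?exprn_gt0 // mulrC -ltr_pdivrMr //.
apply: (lt_trans hn); rewrite -natrX ltr_nat; exact: ltn_expl.
Qed.

Lemma atomless_intermediate A (v : R) : measurable A -> 0 <= v <= pr A ->
  exists B, [/\ measurable B, B `<=` A & pr B = v].
Proof.
move=> mA /andP[v0 vA].
pose inv E := [/\ measurable E, E `<=` A & pr E <= v].
pose adm E C := [/\ measurable C, C `<=` A `\` E & pr E + pr C <= v].
(* greedy exhaustion: add a piece of at least half the best admissible measure *)
have stepE E : exists C, inv E -> adm E C /\ forall C', adm E C' -> pr C' <= 2 * pr C.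
  have [iE|] := pselect (inv E); last by exists set0.
  have [mE EA Ev] := iE.
  pose S := [set pr C | C in adm E].
  have adm0 : adm E set0 by split=> //; rewrite measure0 addr0.
  have supS : has_sup S.
    split; first by exists (pr set0), set0.
    by exists v => _ [C [mC _ hC] <-]; have := pr_ge0 E; lra.
  have Sle C : adm E C -> pr C <= sup S.
    by move=> aC; apply: ub_le_sup; [exact: (proj2 supS)|exists C].
  have [s0|s0] := leP (sup S) 0.
    by exists set0 => _; split=> // C /Sle; rewrite measure0 /=; lra.
  have [|_ [C aC <-] hC] := @sup_adherent _ S (sup S / 2) _ supS; first by lra.
  by exists C => _; split=> // C' /Sle; lra.
have [next hnext] := choice stepE.
pose E n := iter n (fun E => E `|` next E) set0.
have invE n : inv (E n).
  elim: n => [|n iE]; first by split; [exact: measurable0|by move=> w []|rewrite /E /= measure0].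
  have [[mC CA hC] _] := hnext _ iE; have [mE EA Ev] := iE.
  split; [exact: measurableU|by move=> w [/EA//|/CA[]]|].
  rewrite /= prU // -subset0 => w [] Ew /CA[_]; exact.
have mE n : measurable (E n) by have [] := invE n.
have ES n : pr (E n.+1) = pr (E n) + pr (next (E n)).
  have [[mC CA _] _] := hnext _ (invE n).
  by rewrite /= prU // -subset0 => w [] Ew /CA[_]; exact.
pose B := \bigcup_n E n.
have mB : measurable B by exact: bigcupT_measurable.
have BA : B `<=` A by move=> w [n _]; have [_ h _] := invE n; exact: h.
have Bv : pr B <= v.
  have cvB : P (E n) @[n --> \oo] --> P B.
    apply: nondecreasing_cvg_mu => //; apply/nondecreasing_seqP => n.
    by apply/subsetPset => w; left.
  rewrite -lee_fin -prE //; apply: (cvge_to_le cvB).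
  by apply: nearW => n; rewrite prE // lee_fin; have [] := invE n.
exists B; split=> //; apply/eqP; rewrite eq_le Bv leNgt; apply/negP => Blt.
have AB := prD A B mA mB BA.
have [||C [mC CAB C0 Cv]] := atomless_small (A `\` B) (v - pr B) (measurableD mA mB).
- by rewrite AB; lra.
- by lra.
(* If the union [B] fell short of [v], the small piece [C] outside [B] would be admissible at every
   stage, so every greedy step would gain at least [pr C / 2] and the total would exceed [v]. *)
have Cadm n : adm (E n) C.
  split=> //; first by move=> w /CAB[Aw nBw]; split=> // Ew; apply: nBw; exists n.
  have : pr (E n) <= pr B by apply: pr_le => // w Ew; exists n.
  lra.
have big n : n%:R * (pr C / 2) <= pr (E n).
  elim: n => [|n IH]; first by rewrite mul0r; exact: pr_ge0.
  have [_ /(_ C (Cadm n)) h] := hnext _ (invE n).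
  rewrite ES -natr1 mulrDl mul1r; lra.
have [n hn] : exists n, v / (pr C / 2) < n%:R.
  by exists (Num.trunc (v / (pr C / 2))).+1; exact: truncnS_gt.
have := big n; have [_ _] := invE n.
move: hn; rewrite ltr_pdivrMr ?divr_gt0 //; lra.
Qed.

End Sierpinski.

(** * Square integrable variables and the lift *)

Lemma integrable_ge0P {R : realType} {disp : measure_display} {U : measurableType disp}
    (P : {measure set U -> \bar R}) (g : U -> R) :
  measurable_fun setT g -> (forall w, 0 <= g w) ->
  P.-integrable setT (EFin \o g) <-> (\int[P]_w (g w)%:E < +oo)%E.
Proof.
move=> mg g0; have E : (\int[P]_w `|(EFin \o g) w| = \int[P]_w (g w)%:E)%E.
  by apply: eq_integral => w _; rewrite /= ger0_norm.
split=> [/integrableP[_]|h]; first by rewrite E.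
by apply/integrableP; split; [exact/measurable_EFinP|rewrite E].
Qed.

Lemma sqr_le_double_sum {R : realType} (s a b : R) : 0 <= s -> s <= 2 * (a + b) ->
  s ^+ 2 <= 8 * a ^+ 2 + 1 * (8 * b ^+ 2).
Proof.
move=> s0 h; apply: (@le_trans _ _ ((2 * (a + b)) ^+ 2)).
  by rewrite ler_pXn2r ?nnegrE // (le_trans s0).
rewrite -subr_ge0 (_ : _ - _ = 4 * (a - b) ^+ 2); last by ring.
by rewrite mulr_ge0 // sqr_ge0.
Qed.

Section SquareIntegrable.
Context {R : realType} {T : R} {d : nat} (T_gt0 : 0 < T).
Context {d0 : measure_display} {Omt : measurableType d0}.
Variable P : probability Omt R.
Local Notation Om := (Omhat R T d).
Local Notation L2path := (L2path R T d P).
Local Notation L2vec := (L2vec R d P).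
Local Notation stop := (stop R T d).
Local Notation shiftp := (shiftp R T d).
Local Notation supn := (supn R T d).
Implicit Types (X : Omt -> Om) (Y xi : Omt -> 'rV[R]_d).

Lemma L2vecP Y : L2vec Y <->
  vmeasurable Y /\ P.-integrable setT (fun w => (eucl (Y w) ^+ 2)%:E).
Proof.
have H : vmeasurable Y -> P.-integrable setT (fun w => (eucl (Y w) ^+ 2)%:E) <->
    (\int[P]_w (eucl (Y w) ^+ 2)%:E < +oo)%E.
  move=> mY; apply: (integrable_ge0P P (fun w => eucl (Y w) ^+ 2)) => [|w].
    by apply: measurable_funX; exact: measurable_eucl.
  exact: sqr_ge0.
split=> [[/vmeasurableP h1 h2]|[h1 h2]]; first by split=> //; apply/(H h1).
by split; [exact/vmeasurableP|exact/(H h1)].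
Qed.

Lemma L2pathP X : L2path X <->
  measurable_fun setT X /\ P.-integrable setT (fun w => (supn (X w) ^+ 2)%:E).
Proof.
have H : measurable_fun setT X -> P.-integrable setT (fun w => (supn (X w) ^+ 2)%:E) <->
    (\int[P]_w (supn (X w) ^+ 2)%:E < +oo)%E.
  move=> mY; apply: (integrable_ge0P P (fun w => supn (X w) ^+ 2)) => [|w].
    by apply: measurable_funX; exact: measurable_supn.
  exact: sqr_ge0.
by split=> -[h1 h2]; split=> //; apply/(H h1).
Qed.

Lemma integrable_comb (g h : Omt -> R) (a b : R) :
  P.-integrable setT (EFin \o g) -> P.-integrable setT (EFin \o h) ->
  P.-integrable setT (EFin \o (fun w => a * g w + b * h w)).
Proof.
move=> ig ih; rewrite (_ : _ \o _ = (fun w => a%:E * (g w)%:E + b%:E * (h w)%:E)%E) //.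
by apply: integrableD => //; exact: integrableZl.
Qed.

Lemma L2vecB Y Y' : L2vec Y -> L2vec Y' -> L2vec (fun w => Y w - Y' w).
Proof.
move=> /L2vecP[mY iY] /L2vecP[mY' iY']; apply/L2vecP.
have mB := vmeasurableB _ _ mY mY'; split=> //.
apply: le_integrable (integrable_comb _ _ 2 2 iY iY') => //.
  exact: measurable_eucl_sqr.
move=> w _; rewrite /= lee_fin !ger0_norm ?sqr_ge0 //; first exact: eucl_sqrB.
by rewrite addr_ge0 // mulr_ge0 // sqr_ge0.
Qed.

Lemma L2vecZ (c : R) Y : L2vec Y -> L2vec (fun w => c *: Y w).
Proof.
move=> /L2vecP[mY iY]; apply/L2vecP; split; first exact: vmeasurableZ.
rewrite (_ : (fun _ => _) = (fun w => (c ^+ 2)%:E * (eucl (Y w) ^+ 2)%:E)%E).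
  exact: integrableZl.
by apply/funext => w; rewrite euclZ exprMn real_normK ?num_real // EFinM.
Qed.

Lemma integrable_dotv Y Y' : L2vec Y -> L2vec Y' ->
  P.-integrable setT (EFin \o (fun w => dotv (Y w) (Y' w))).
Proof.
move=> /L2vecP[mY iY] /L2vecP[mY' iY'].
apply: le_integrable (integrable_comb _ _ 1 1 iY iY') => //.
  by apply/measurable_EFinP; exact: measurable_dotv.
move=> w _; rewrite /= lee_fin !mul1r [leRHS]ger0_norm; first exact: dotv_le.
by rewrite addr_ge0 // sqr_ge0.
Qed.

(** The difference [Y - Y'] is itself the test direction, so equality of the two pairings says that
    its mean square is 0. *)
Lemma L2vec_ae_eq Y Y' : L2vec Y -> L2vec Y' ->
  fine (\int[P]_w (dotv (Y w) (Y w - Y' w))%:E) =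
  fine (\int[P]_w (dotv (Y' w) (Y w - Y' w))%:E) ->
  {ae P, forall w, Y w = Y' w}.
Proof.
move=> hY hY'; have hB := L2vecB _ _ hY hY'.
have /L2vecP[mB iB] := hB; move/eqP; rewrite -subr_eq0.
have -> : fine (\int[P]_w (dotv (Y w) (Y w - Y' w))%:E) -
   fine (\int[P]_w (dotv (Y' w) (Y w - Y' w))%:E) =
   fine (\int[P]_w (eucl (Y w - Y' w) ^+ 2)%:E).
  rewrite -RintegralB //; [|exact: integrable_dotv|exact: integrable_dotv].
  congr fine; apply: eq_integral => w _ /=.
  by rewrite -dotvBl dotvv.
move=> /eqP e0; have e0' : (\int[P]_w `|(eucl (Y w - Y' w) ^+ 2)%:E| = 0)%E.
  rewrite -[RHS](_ : (fine (\int[P]_w (eucl (Y w - Y' w) ^+ 2)%:E))%:E = _); last by rewrite e0.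
  rewrite fineK; last exact: integrable_fin_num.
  by apply: eq_integral => w _; rewrite gee0_abs // lee_fin sqr_ge0.
move: e0' => /(ae_eq_integral_abs _ measurableT (measurable_eucl_sqr _ mB)).
apply: filterS => w /(_ I) /= [] /eucl_eq0 /eqP; rewrite subr_eq0 => /eqP; exact.
Qed.

Lemma L2path_le X X' (a : R) (g : Omt -> R) : L2path X -> measurable_fun setT X' ->
  P.-integrable setT (EFin \o g) ->
  (forall w, supn (X' w) ^+ 2 <= a * supn (X w) ^+ 2 + 1 * g w) -> L2path X'.
Proof.
move=> /L2pathP[mX iX] mX' ig h; apply/L2pathP; split=> //.
apply: le_integrable (integrable_comb _ _ a 1 iX ig) => //.
  exact: measurable_supn_sqr.
move=> w _; rewrite /= lee_fin ger0_norm ?sqr_ge0 // (le_trans (h w)) //.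
exact: ler_norm.
Qed.

Lemma L2path_stop t X : 0 <= t <= T -> L2path X -> L2path (fun w => stop t (X w)).
Proof.
move=> tT hX; have /L2pathP[mX iX] := hX.
have mS : measurable_fun setT (fun w => stop t (X w) : Om).
  apply: measurable_stop => //; apply: measurable_coordG_le mX.
  by case/andP: tT.
apply: (L2path_le X _ 1 (cst 0)) => //; first exact: integrable0.
move=> w; rewrite mulr0 addr0 mul1r ler_pXn2r ?nnegrE ?supn_ge0 //.
by apply: supn_le => // s _; rewrite stopE //; exact: eucl_le_supn.
Qed.

Lemma L2path_shiftp t X xi : L2path X -> L2vec xi ->
  L2path (fun w => shiftp t (X w) (xi w)).
Proof.
move=> hX /L2vecP[mxi ixi]; have /L2pathP[mX iX] := hX.
apply: (L2path_le X _ 8 (fun w => 8 * eucl (xi w) ^+ 2)) => //.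
- exact: measurable_shiftp.
- have := integrable_comb _ _ 8 0 ixi ixi.
  by under eq_fun do rewrite mul0r addr0.
move=> w; apply: sqr_le_double_sum; first exact: supn_ge0.
apply: supn_le => // s _; rewrite shiftpE // (le_trans (eucl_leD _ _)) // ler_pM2l //.
rewrite lerD ?eucl_le_supn //; case: ifP => // _.
by rewrite eucl0 eucl_ge0.
Qed.

Lemma L2path_discretize n X : L2path X -> L2path (fun w => discretize n (X w)).
Proof.
move=> hX; have /L2pathP[mX iX] := hX.
apply: (L2path_le X _ 8 (cst (8 * (2 * d%:R) ^+ 2))) => //.
- exact: measurable_discretize.
- exact: finite_measure_integrable_cst.
move=> w; apply: sqr_le_double_sum; first exact: supn_ge0.
by rewrite [X in 2 * X]addrC; exact: supn_discretize.
Qed.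

Lemma P2_law X : L2path X -> P2 R T d (law R T d P X).
Proof.
move=> /[dup] -[mX iX] hX.
have [Q [QE Qint _]] := image_probability P X mX; exists Q; split=> //.
rewrite (Qint (fun v => (supn v ^+ 2)%:E)) //.
  exact: (measurable_supn_sqr T_gt0 (fun v : Om => v) (@measurable_id _ _ _)).
by move=> v; rewrite lee_fin sqr_ge0.
Qed.

Definition same_stopped_law t X X' := forall A : set Om, measurable A ->
  P ((fun w => stop t (X w) : Om) @^-1` A) = P ((fun w => stop t (X' w) : Om) @^-1` A).

Variable f : R -> (set Om -> \bar R) -> R.
Hypothesis hf : cont_Theta R T d f.

(** The law of [(S, S)], with [S] the stopped [X], couples both stopped laws at zero cost, and
    continuity equates the values of [f] at zero distance. Agreement on measurable sets suffices,
    because couplings test only those. *)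
Lemma lift_same_stopped_law t X X' : 0 <= t <= T -> L2path X -> L2path X' ->
  same_stopped_law t X X' -> Defs.lift R T d P f t X = Defs.lift R T d P f t X'.
Proof.
move=> tT hX hX' sl; have [mS _] := L2path_stop t X tT hX.
have mdiag : measurable_fun setT (fun w => (stop t (X w) : Om, stop t (X w) : Om)).
  exact: measurable_fun_pair.
have [Q [QE _ Q0]] := image_probability P _ mdiag.
have W0 : (W2Theta_sq R T d t (law R T d P X) t (law R T d P X') <= 0)%E.
  rewrite /W2Theta_sq subrr normr0 add0e; apply: ereal_inf_lbound; exists Q.
    move=> A mA; rewrite !QE; split=> //=; exact: sl.
  apply: (Q0 (fun z : Om * Om => dSK R T d z.1 z.2 ^+ 2)) => [v|w] /=.
    exact: sqr_ge0.
  by rewrite dSKxx // expr0n.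
apply/eqP; rewrite -subr_eq0 -normr_le0; apply/ler_addgt0Pr => e e0; rewrite add0r ltW //.
have [del del0 hdel] := hf t (law R T d P X) tT (P2_law _ hX) e e0.
apply: hdel => //; first exact: P2_law.
by apply: le_lt_trans W0 _; rewrite lte_fin exprn_gt0.
Qed.

Lemma norm2Z (c : R) xi : L2vec xi -> norm2 R d P (fun w => c *: xi w) = `|c| * norm2 R d P xi.
Proof.
move=> /L2vecP[mxi ixi]; rewrite /norm2.
have -> : fine (\int[P]_w (eucl (c *: xi w) ^+ 2)%:E) =
  c ^+ 2 * fine (\int[P]_w (eucl (xi w) ^+ 2)%:E).
  rewrite -RintegralZl //; congr fine; apply: eq_integral => w _ /=.
  by rewrite euclZ exprMn real_normK ?num_real.
by rewrite sqrtrM ?sqr_ge0 // sqrtr_sqr.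
Qed.

(** At scale [c] the lifts agree, and at scale 0 the base values agree, so subtracting the two
    expansions bounds [c * |a - b|] by [r * c * (N + N')]; then [c] cancels. *)
Lemma frechet_same_law t X X' Y Y' xi xi' : 0 <= t <= T -> L2path X -> L2path X' ->
  L2vec Y -> L2vec Y' -> L2vec xi -> L2vec xi' ->
  frechet_at R T d P f t X Y -> frechet_at R T d P f t X' Y' ->
  (forall c, 0 <= c -> same_stopped_law t
     (fun w => shiftp t (X w) (c *: xi w)) (fun w => shiftp t (X' w) (c *: xi' w))) ->
  fine (\int[P]_w (dotv (Y w) (xi w))%:E) = fine (\int[P]_w (dotv (Y' w) (xi' w))%:E).
Proof.
move=> tT hX hX' hY hY' hxi hxi' fr fr' sl.
have slE c : 0 <= c -> Defs.lift R T d P f t (fun w => shiftp t (X w) (c *: xi w)) =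
    Defs.lift R T d P f t (fun w => shiftp t (X' w) (c *: xi' w)).
  move=> c0; exact: (lift_same_stopped_law t _ _ tT
    (L2path_shiftp t _ _ hX (L2vecZ c _ hxi)) (L2path_shiftp t _ _ hX' (L2vecZ c _ hxi')) (sl c c0)).
have shift0 (Z : Omt -> Om) (z : Omt -> 'rV[R]_d) : (fun w => shiftp t (Z w) (0 *: z w)) = Z.
  apply/funext => w; apply: (path_ext T_gt0) => s _; rewrite shiftpE //.
  by rewrite scale0r; case: ifP; rewrite addr0.
have sl0 := slE 0 (lexx 0); rewrite !shift0 in sl0.
set a := fine _; set b := fine _.
apply/eqP; rewrite -subr_eq0 -normr_le0; apply/ler_addgt0Pr => e e0; rewrite add0r.
set N := norm2 R d P xi; set N' := norm2 R d P xi'.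
have N0 : 0 <= N by exact: sqrtr_ge0.
have N'0 : 0 <= N' by exact: sqrtr_ge0.
(* The added 1 keeps the denominator positive when both directions have norm 0; the same denominator
   in [c] below puts [c * N] and [c * N'] under the two radii. *)
pose r := e / (N + N' + 1).
have NN0 : 0 < N + N' + 1 by lra.
have r0 : 0 < r by rewrite divr_gt0.
have rE : r * (N + N' + 1) = e by rewrite /r divfK // gt_eqF.
have [del del0 hdel] := fr r r0; have [del' del'0 hdel'] := fr' r r0.
pose c := Num.min del del' / (N + N' + 1) / 2.
have m0 : 0 < Num.min del del' by rewrite lt_min del0.
have c0 : 0 < c by rewrite !divr_gt0.
have cE : c * (N + N' + 1) * 2 = Num.min del del'.
  by rewrite /c; field; rewrite gt_eqF.
have m1 : Num.min del del' <= del by rewrite ge_min lexx.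
have m2 : Num.min del del' <= del' by rewrite ge_min lexx orbT.
have h1 := hdel _ (L2vecZ c _ hxi); have h2 := hdel' _ (L2vecZ c _ hxi').
have dE (Z z : Omt -> 'rV[R]_d) : L2vec Z -> L2vec z ->
    fine (\int[P]_w (dotv (Z w) (c *: z w))%:E) = c * fine (\int[P]_w (dotv (Z w) (z w))%:E).
  move=> hZ hz; rewrite -RintegralZl //; last exact: integrable_dotv.
  by congr fine; apply: eq_integral => w _ /=; rewrite dotvZr.
rewrite !norm2Z // (gtr0_norm c0) !dE // -/a -/b -/N -/N' slE ?(ltW c0) // sl0 in h1 h2.
set F := Defs.lift R T d P f t _ in h1 h2; set F0 := Defs.lift R T d P f t X' in h1 h2.
have cN0 : 0 <= c * N by rewrite mulr_ge0 // ltW.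
have cN'0 : 0 <= c * N' by rewrite mulr_ge0 // ltW.
have rc0 : 0 < r * c by rewrite mulr_gt0.
have /h1 : c * N < del by lra.
have /h2 : c * N' < del' by lra.
rewrite !ler_norml => /andP[k1 k2] /andP[k3 k4].
have c1 : c * (a - b) <= c * e by rewrite -rE; lra.
have c2 : c * (b - a) <= c * e by rewrite -rE; lra.
move: c1 c2; rewrite !ler_pM2l // => c1 c2.
by apply/andP; split; lra.
Qed.

End SquareIntegrable.

(** * Exchangeability forces constancy on the fibers of a discrete variable *)

Section AtomlessExchange.
Context {R : realType} {disp : measure_display} {U : measurableType disp}.
Variable P : probability U R.
Implicit Types (A B E : set U) (g y : U -> R).
Local Notation integ g := (P.-integrable setT (EFin \o g)).

Lemma integrable_indicM A g : measurable A -> integ g -> integ (fun w => \1_A w * g w).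
Proof.
move=> mA ig; have mg : measurable_fun setT g by apply/measurable_EFinP; exact: (measurable_int P).
apply: le_integrable ig => //.
  by apply/measurable_EFinP; apply: measurable_funM => //; exact: measurable_indic.
move=> w _; rewrite /= lee_fin indicE normrM; case: (w \in A).
  by rewrite normr1 mul1r.
by rewrite normr0 mul0r.
Qed.

Lemma Rintegral_indicM_subr A g (r : R) : measurable A -> integ g ->
  \int[P]_w (\1_A w * (r - g w)) = r * fine (P A) - \int[P]_w (\1_A w * g w).
Proof.
move=> mA ig; have iA : integ (\1_A : U -> R) by exact: integrable_indic.
rewrite (_ : (fun w => _) = (fun w => r * \1_A w - \1_A w * g w)); last first.
  by apply/funext => w; rewrite mulrBr mulrC.
rewrite RintegralB //; last 2 first.
- by have := integrableZl measurableT r iA.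
- exact: integrable_indicM.
by rewrite RintegralZl // /Rintegral integral_indic // setIT.
Qed.

Lemma pos_integral0_null A g : measurable A -> integ g -> (forall w, A w -> 0 < g w) ->
  \int[P]_w (\1_A w * g w) = 0 -> P A = 0%E.
Proof.
move=> mA ig gA h; have ih := integrable_indicM A g mA ig.
have /(ae_eq_integral_abs _ measurableT (measurable_int P ih)) :
    (\int[P]_w `|(EFin \o (fun w => (\1_A w * g w)%R)) w| = 0)%E.
  have fin := integrable_fin_num measurableT ih.
  rewrite (eq_integral (EFin \o (fun w => \1_A w * g w))) => [|w _].
    by rewrite -(fineK fin); congr EFin; exact: h.
  rewrite /= ger0_norm // indicE; case: (boolP (w \in A)) => wA; last by rewrite mul0r.
  by rewrite mul1r ltW // gA //; exact: set_mem.
move=> ae0; apply: measure_negligible => //.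
apply: negligibleS ae0 => w Aw /= /(_ I) [].
rewrite indicE mem_set // mul1r => gw0.
by have := gA w Aw; rewrite gw0 ltxx.
Qed.

Lemma integral0_null E g : measurable E -> measurable_fun setT g -> integ g ->
  \int[P]_w (\1_E w * g w) = 0 -> P (E `&` [set w | g w < 0]) = 0%E ->
  P (E `&` [set w | 0 < g w]) = 0%E.
Proof.
move=> mE mg ig h hneg.
have mlt : measurable (E `&` [set w | g w < 0]).
  by apply: measurableI => //; rewrite -preimage_itvNyo -[X in measurable X]setTI; exact: mg.
have mgt : measurable (E `&` [set w | 0 < g w]).
  by apply: measurableI => //; rewrite -preimage_itvoy -[X in measurable X]setTI; exact: mg.
apply: (pos_integral0_null _ g) => //; first by move=> w [].
rewrite -[RHS]h; congr fine; apply: ae_eq_integral => //.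
- exact: (measurable_int P (integrable_indicM _ _ mgt ig)).
- exact: (measurable_int P (integrable_indicM _ _ mE ig)).
exists (E `&` [set w | g w < 0]); split=> // w /= hw.
apply: contrapT => nw; apply: hw => _; congr EFin; rewrite !indicE in_setI.
case: (boolP (w \in E)) => wE //=.
have [gw|gw|->] := ltgtP (g w) 0; last by rewrite !mulr0.
  by exfalso; apply: nw; split=> //; exact: set_mem.
by rewrite (_ : w \in [set w | 0 < g w]) //; exact/mem_set.
Qed.

Hypothesis hP : atomless R P.

Definition exchangeable_on E y := forall A B, measurable A -> measurable B ->
  A `<=` E -> B `<=` E -> A `&` B = set0 -> P A = P B ->
  \int[P]_w (\1_A w * y w) = \int[P]_w (\1_B w * y w).

(** Otherwise Sierpinski's theorem provides sets [A] and [B] of common probability [p > 0], with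
    [y < r] on [A] and [y >= r] on [B]. Then the integral of [y] over [A] is below [r * p], the one
    over [B] is not, and exchangeability fails. *)
Lemma exchangeable_dichotomy E y (r : R) : measurable E -> measurable_fun setT y -> integ y ->
  exchangeable_on E y ->
  P (E `&` [set w | y w < r]) = 0%E \/ P (E `&` [set w | r <= y w]) = 0%E.
Proof.
move=> mE my iy ex.
set A0 := E `&` _; set B0 := E `&` _.
have mA0 : measurable A0.
  by apply: measurableI => //; rewrite -preimage_itvNyo -[X in measurable X]setTI; exact: my.
have mB0 : measurable B0.
  by apply: measurableI => //; rewrite -preimage_itvcy -[X in measurable X]setTI; exact: my.
pose a := fine (P A0); pose b := fine (P B0).
have a0 : 0 <= a by exact: fine_ge0.
have b0 : 0 <= b by exact: fine_ge0.
have [->|aN0] := eqVneq (P A0) 0%E; first by left.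
have [->|bN0] := eqVneq (P B0) 0%E; first by right.
have agt : 0 < a.
  rewrite lt_def a0 andbT; apply: contraNneq aN0 => a00.
  by rewrite (prE P A0 mA0) -/a a00.
have bgt : 0 < b.
  rewrite lt_def b0 andbT; apply: contraNneq bN0 => b00.
  by rewrite (prE P B0 mB0) -/b b00.
pose p := Num.min a b.
have p0 : 0 < p by rewrite lt_min agt.
have [|A [mA AA0 pA]] := atomless_intermediate P hP A0 p mA0.
  by rewrite (ltW p0) ge_min lexx.
have [|B [mB BB0 pB]] := atomless_intermediate P hP B0 p mB0.
  by rewrite (ltW p0) ge_min lexx orbT.
have AB : P A = P B by rewrite (prE P A mA) (prE P B mB) pA pB.
exfalso; have ir : integ (fun w => r - y w).
  have ic : integ (cst r) by exact: finite_measure_integrable_cst.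
  by have := integrableB measurableT ic iy.
have e1 := Rintegral_indicM_subr A y r mA iy.
have e2 := Rintegral_indicM_subr B y r mB iy.
have exAB : \int[P]_w (\1_A w * y w) = \int[P]_w (\1_B w * y w).
  apply: ex => //; [by move=> w /AA0[]|by move=> w /BB0[]|].
  rewrite -subset0 => w [/AA0[_ /= h1] /BB0[_ /= h2]].
  by have := lt_le_trans h1 h2; rewrite ltxx.
have h1 : 0 <= \int[P]_w (\1_A w * (r - y w)).
  apply: Rintegral_ge0 => w _; rewrite indicE.
  case: (boolP (w \in A)) => wA; last by rewrite mul0r.
  by rewrite mul1r subr_ge0 ltW //; have [_] := AA0 _ (set_mem wA).
have h2 : \int[P]_w (\1_B w * (r - y w)) <= 0.
  rewrite -oppr_ge0 -[X in 0 <= X]mulN1r -RintegralZl //; last exact: integrable_indicM.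
  apply: Rintegral_ge0 => w _; rewrite indicE.
  case: (boolP (w \in B)) => wB; last by rewrite mul0r mulr0.
  by rewrite mul1r mulN1r opprB subr_ge0; have [_] := BB0 _ (set_mem wB).
have hA : \int[P]_w (\1_A w * (r - y w)) = 0.
  by apply/eqP; rewrite eq_le h1 andbT e1 exAB pA -pB -e2.
have : P A = 0%E.
  apply: (pos_integral0_null _ (fun w => r - y w)) => // w /AA0[_ /=].
  by rewrite subr_gt0.
rewrite (prE P A mA) pA => -[] p00; move: p0; rewrite p00 ltxx //.
Qed.

Lemma exchangeable_ae_cst E y : measurable E -> measurable_fun setT y -> integ y ->
  exchangeable_on E y -> exists m : R, {ae P, forall w, E w -> y w = m}.
Proof.
move=> mE my iy ex.
have ic (r : R) : integ (cst r) by exact: finite_measure_integrable_cst.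
have [PE0|PEN0] := eqVneq (P E) 0%E.
  by exists 0; exists E; split=> // w /= /not_implyP[].
have pE : fine (P E) != 0.
  by apply: contraNneq PEN0 => h; rewrite (prE P E mE) h.
(* The mean over [E] is the only threshold needed: [m - y] has integral 0 over [E], so once one
   strict sign is negligible, so is the other. *)
pose m := \int[P]_w (\1_E w * y w) / fine (P E).
have mE0 : \int[P]_w (\1_E w * (m - y w)) = 0.
  by rewrite Rintegral_indicM_subr // /m divfK // subrr.
have imy : integ (fun w => m - y w) by have := integrableB measurableT (ic m) iy.
have iym : integ (fun w => y w - m) by have := integrableB measurableT iy (ic m).
have mE0' : \int[P]_w (\1_E w * (y w - m)) = 0.
  rewrite (_ : (fun w => _) = (fun w => -1 * (\1_E w * (m - y w)))); last first.
    by apply/funext => w; rewrite mulN1r -mulrN opprB.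
  by rewrite RintegralZl // ?mE0 ?mulr0 //; exact: integrable_indicM.
have mmy : measurable_fun setT (fun w => m - y w) by exact: measurable_funB.
have mym : measurable_fun setT (fun w => y w - m) by exact: measurable_funB.
have lt0 : P (E `&` [set w | y w < m]) = 0%E.
  (* The first alternative is the claim. In the second, [y > m] is negligible on [E], and the
     vanishing integral of [m - y] makes [y < m] negligible as well. *)
  have [//|ge0] := exchangeable_dichotomy E y m mE my iy ex.
  have := integral0_null E (fun w => m - y w) mE mmy imy mE0.
  rewrite (_ : [set w | 0 < m - y w] = [set w | y w < m]); last first.
    by apply/seteqP; split => w /=; rewrite subr_gt0.
  apply; apply: (@subset_measure0 _ _ _ P _ (E `&` [set w | m <= y w])) => //.
  - apply: measurableI => //; rewrite -preimage_itvNyo -[X in measurable X]setTI; exact: mmy.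
  - apply: measurableI => //; rewrite -preimage_itvcy -[X in measurable X]setTI; exact: my.
  - by move=> w [Ew /=]; rewrite subr_lt0 => h; split=> //=; exact: ltW.
have gt0 : P (E `&` [set w | m < y w]) = 0%E.
  have := integral0_null E (fun w => y w - m) mE mym iym mE0'.
  rewrite (_ : [set w | 0 < y w - m] = [set w | m < y w]); last first.
    by apply/seteqP; split => w /=; rewrite subr_gt0.
  apply; rewrite -[RHS]lt0; congr (P (_ `&` _)).
  by apply/seteqP; split => w /=; rewrite subr_lt0.
exists m; exists ((E `&` [set w | y w < m]) `|` (E `&` [set w | m < y w])); split.
- apply: measurableU; apply: measurableI => //; rewrite -[X in measurable X]setTI.
    by rewrite -preimage_itvNyo; exact: my.
  by rewrite -preimage_itvoy; exact: my.
- apply: null_set_setU => //; apply: measurableI => //; rewrite -[X in measurable X]setTI.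
    by rewrite -preimage_itvNyo; exact: my.
  by rewrite -preimage_itvoy; exact: my.
move=> w /= /not_implyP[Ew /eqP]; rewrite neq_lt => /orP[h|h]; first by left.
by right.
Qed.

End AtomlessExchange.

(** * Perturbations on equiprobable sets inside a fiber *)

Section FiberConstancy.
Context {R : realType} {T : R} {d : nat} (T_gt0 : 0 < T).
Context {d0 : measure_display} {Omt : measurableType d0}.
Variable P : probability Omt R.
Hypothesis hP : atomless R P.
Local Notation Om := (Omhat R T d).
Local Notation L2path := (L2path R T d P).
Local Notation L2vec := (L2vec R d P).
Local Notation stop := (stop R T d).
Local Notation shiftp := (shiftp R T d).

Lemma measure_split3 (S A B : set Omt) : measurable S -> measurable A -> measurable B ->
  A `&` B = set0 -> P S = (P (S `\` (A `|` B)) + (P (S `&` A) + P (S `&` B)))%E.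
Proof.
move=> mS mA mB AB; rewrite (measureDI P mS (measurableU _ _ mA mB)); congr (_ + _)%E.
rewrite setIUr measureU //; [exact: measurableI|exact: measurableI|].
by rewrite setIACA AB setI0.
Qed.

Definition indic_vec (A : set Omt) (i : 'I_d) (w : Omt) : 'rV[R]_d :=
  \1_A w *: delta_mx ord0 i.

Lemma L2vec_indic_vec A i : measurable A -> L2vec (indic_vec A i).
Proof.
move=> mA; apply/L2vecP.
have mv : vmeasurable (indic_vec A i).
  move=> j; rewrite (_ : (fun _ => _) =
      (fun w => \1_A w * (delta_mx ord0 i : 'rV[R]_d) ord0 j)).
    by apply: measurable_funM => //; exact: measurable_indic.
  by apply/funext => w; rewrite mxE.
split=> //; apply: (@le_integrable _ _ _ P setT measurableT _
   (EFin \o cst (eucl (delta_mx ord0 i : 'rV[R]_d) ^+ 2))).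
- exact: measurable_eucl_sqr.
- move=> w _; rewrite /= lee_fin !ger0_norm ?sqr_ge0 // euclZ exprMn indicE.
  case: (w \in A); rewrite ?normr1 ?expr1n ?mul1r //.
  by rewrite normr0 expr0n mul0r sqr_ge0.
- exact: finite_measure_integrable_cst.
Qed.

Lemma dotv_indic_vec (v : 'rV[R]_d) A i w : dotv v (indic_vec A i w) = \1_A w * v ord0 i.
Proof.
rewrite dotvZr; congr (_ * _); rewrite /dotv (bigD1 i) //= big1 => [|j ji].
  by rewrite mxE !eqxx mulr1 addr0.
by rewrite mxE eqxx (negbTE ji) mulr0.
Qed.

(** Where [X] equals [x], the stopped path is [z1] with the jump and [z0] without it. Exchanging [A]
    and [B] exchanges the places of these two values, whose probabilities agree, and nothing changes
    elsewhere. *)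
Lemma same_stopped_law_indic t (X : Omt -> Om) (x : cpath R T d) A B i (c : R) :
  0 <= t <= T -> measurable_fun setT X -> measurable A -> measurable B ->
  A `&` B = set0 -> P A = P B -> (forall w, (A `|` B) w -> X w = x) ->
  same_stopped_law P t (fun w => shiftp t (X w) (c *: indic_vec A i w))
                       (fun w => shiftp t (X w) (c *: indic_vec B i w)).
Proof.
move=> tT mX mA mB AB PAB Xx G mG.
have mS E : measurable E ->
    measurable ((fun w => stop t (shiftp t (X w) (c *: indic_vec E i w)) : Om) @^-1` G).
  move=> mE; rewrite -[X in measurable X]setTI.
  have [mE' _] := L2vec_indic_vec E i mE.
  have ms : measurable_fun setT (fun w => shiftp t (X w) (c *: indic_vec E i w) : Om).
    by apply: measurable_shiftp => //; apply: vmeasurableZ; exact/vmeasurableP.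
  have tT' : t <= T by case/andP: tT.
  exact: (measurable_stop T_gt0 _ _ tT (measurable_coordG_le _ _ _ tT' ms)).
pose z1 := stop t (shiftp t x (c *: delta_mx ord0 i)).
pose z0 := stop t (shiftp t x (c *: 0)).
have inE E w : E w -> indic_vec E i w = delta_mx ord0 i.
  by move=> Ew; rewrite /indic_vec indicE mem_set // scale1r.
have notinE E w : ~ E w -> indic_vec E i w = 0.
  by move=> Ew; rewrite /indic_vec indicE memNset // scale0r.
have disj w : A w -> ~ B w by move=> Aw Bw; have : (A `&` B) w by []; rewrite AB.
set SA := _ @^-1` G; set SB := _ @^-1` G.
rewrite (measure_split3 SA A B (mS A mA) mA mB AB) (measure_split3 SB A B (mS B mB) mA mB AB).
congr (_ + _)%E.
  congr (P _); apply/seteqP; split => w [+ nAB].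
    have [nA nB] : ~ A w /\ ~ B w by split=> ?; apply: nAB; [left|right].
    by rewrite /SA /SB /= (notinE A w nA) (notinE B w nB).
  have [nA nB] : ~ A w /\ ~ B w by split=> ?; apply: nAB; [left|right].
  by rewrite /SA /SB /= (notinE A w nA) (notinE B w nB).
have hit E z : (forall w, E w -> stop t (shiftp t (X w) (c *: indic_vec A i w)) = z) ->
    P (SA `&` E) = if pselect (G z) then P E else 0%E.
  move=> hz; case: pselect => Gz.
    by congr (P _); apply/seteqP; split => [w []//|w Ew]; split=> //; rewrite /SA /= hz.
  rewrite (_ : _ `&` _ = set0) ?measure0 // -subset0 => w [+ Ew].
  by rewrite /SA /= hz.
have hit' E z : (forall w, E w -> stop t (shiftp t (X w) (c *: indic_vec B i w)) = z) ->
    P (SB `&` E) = if pselect (G z) then P E else 0%E.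
  move=> hz; case: pselect => Gz.
    by congr (P _); apply/seteqP; split => [w []//|w Ew]; split=> //; rewrite /SB /= hz.
  rewrite (_ : _ `&` _ = set0) ?measure0 // -subset0 => w [+ Ew].
  by rewrite /SB /= hz.
rewrite (hit A z1) => [|w Aw]; last by rewrite inE // Xx //; left.
rewrite (hit B z0) => [|w Bw]; last first.
  by rewrite (notinE A w) ?Xx //; [right|move=> /disj].
rewrite (hit' A z0) => [|w Aw]; last by rewrite (notinE B w (disj w Aw)) Xx //; left.
rewrite (hit' B z1) => [|w Bw]; last by rewrite inE // Xx //; right.
by rewrite PAB addeC.
Qed.

Variable f : R -> (set Om -> \bar R) -> R.
Hypothesis hf : cont_Theta R T d f.
Variable t : R.
Hypothesis tT : 0 <= t <= T.

Lemma derivative_fiber_cst (C : countType) (q : Omt -> C) (D : C -> Om)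
    (Y : Omt -> 'rV[R]_d) :
  (forall c, measurable (q @^-1` [set c])) ->
  L2path (fun w => D (q w)) -> L2vec Y ->
  frechet_at R T d P f t (fun w => D (q w)) Y ->
  exists a : C -> 'rV[R]_d, {ae P, forall w, Y w = a (q w)}.
Proof.
move=> mq hX hY fr; have [mX _] := hX; have /L2vecP[mY _] := hY.
have iY i : P.-integrable setT (EFin \o (fun w => Y w ord0 i)).
  have := integrable_dotv P _ _ hY (L2vec_indic_vec setT i measurableT).
  by under eq_fun do rewrite dotv_indic_vec indicT mul1r.
have cst_fiber (p : C * 'I_d) : exists m : R,
    {ae P, forall w, (q @^-1` [set p.1]) w -> Y w ord0 p.2 = m}.
  case: p => c i /=; apply: (exchangeable_ae_cst P hP); [exact: mq|exact: mY|exact: iY|].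
  move=> A B mA mB AE BE AB PAB.
  have := frechet_same_law T_gt0 P f hf t _ _ _ _ _ _ tT hX hX hY hY
     (L2vec_indic_vec A i mA) (L2vec_indic_vec B i mB) fr fr.
  under eq_integral do rewrite dotv_indic_vec.
  under [in X in _ = fine X]eq_integral do rewrite dotv_indic_vec.
  apply=> r _; apply: (same_stopped_law_indic _ _ (D c)) => //.
  by move=> w [/AE|/BE] /= ->.
have [m hm] := choice cst_fiber.
exists (fun c => \row_i m (c, i)).
(* One null set for each pair of a code and a coordinate; [pickle] numbers the pairs by naturals so
   that countably many null sets are merged. *)
have : {ae P, forall w (k : nat), forall p, unpickle k = Some p ->
    q w = p.1 -> Y w ord0 p.2 = m p}.
  apply: ae_foralln => k; case E : (unpickle k) => [p|]; last exact: aeW.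
  by apply: filterS (hm p) => w h _ [<-] /h.
apply: filterS => w h; apply/rowP => i; rewrite mxE.
exact: (h (pickle (q w, i)) (q w, i) (pickleK _)).
Qed.

End FiberConstancy.

(** * Factorization of the derivative *)

Lemma L2_cvg_ae_subseq {R : realType} {d : nat} {disp : measure_display}
    {U : measurableType disp} (P : probability U R)
    (Yn : nat -> U -> 'rV[R]_d) (Y : U -> 'rV[R]_d) :
  (forall n, vmeasurable (Yn n)) -> vmeasurable Y ->
  (\int[P]_w (eucl (Yn n w - Y w) ^+ 2)%:E)%E @[n --> \oo] --> 0%E ->
  exists s : nat -> nat,
    {ae P, forall w, forall i, Yn (s k) w ord0 i @[k --> \oo] --> Y w ord0 i}.
Proof.
move=> mYn mY cv.
have small k : exists n,
    (\int[P]_w (eucl (Yn n w - Y w) ^+ 2)%:E <= (1 / (2 ^ k.+1)%:R)%:E)%E.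
  have e0 : 0 < 1 / (2 ^ k.+1)%:R :> R by rewrite divr_gt0 // ltr0n expn_gt0.
  have : \forall n \near \oo,
      (\int[P]_w (eucl (Yn n w - Y w) ^+ 2)%:E < (1 / (2 ^ k.+1)%:R)%:E)%E.
    by apply: (cv [set x | (x < (1 / (2 ^ k.+1)%:R)%:E)%E]); apply: open_nbhs_nbhs; split;
      [exact: open_ereal_lt_ereal|rewrite /= lte_fin].
  by move=> [n _ hn]; exists n; apply: ltW; exact: hn (leqnn n).
have [s hs] := choice small; exists s.
pose g k w := eucl (Yn (s k) w - Y w) ^+ 2.
have g0 k w : 0 <= g k w by exact: sqr_ge0.
have mg k : measurable_fun setT (fun w => (g k w)%:E).
  by apply: measurable_eucl_sqr; exact: vmeasurableB.
have ig : (\int[P]_w (\sum_(k <oo) (g k w)%:E) < +oo)%E.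
  rewrite integral_nneseries //; last by move=> n w _; rewrite lee_fin.
  apply: (@le_lt_trans _ _ 1%E); last exact: ltry.
  apply: le_trans (epsilon_trick0 xpredT ler01); apply: lee_nneseries => [k _ _|k _].
    by apply: integral_ge0 => w _; rewrite lee_fin.
  exact: hs.
have isum : P.-integrable setT (fun w => \sum_(k <oo) (g k w)%:E)%E.
  apply/integrableP; split.
    by apply: ge0_emeasurable_sum => // k w _ _; rewrite lee_fin.
  rewrite (eq_integral (fun w => \sum_(k <oo) (g k w)%:E)%E) // => w _.
  by rewrite gee0_abs // nneseries_ge0 // => k _ _; rewrite lee_fin.
have := integrable_ae measurableT isum; apply: filterS => w /(_ I) fin i.
have gcv : g k w @[k --> \oo] --> (0 : R).
  apply: cvg_series_cvg_0; apply: nnseries_is_cvg => //.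
  by move: fin; rewrite fin_numE => /andP[_]; rewrite ltey.
apply/cvgrPdist_lt => e e0.
have e20 : 0 < e ^+ 2 by rewrite exprn_gt0.
have /cvgrPdist_lt /(_ _ e20) := gcv; apply: filterS => k.
rewrite sub0r normrN ger0_norm // => gk.
rewrite distrC -(@ltr_pXn2r _ 2) ?nnegrE ?(ltW e0) //; apply: le_lt_trans gk.
rewrite /g ler_pXn2r ?nnegrE ?eucl_ge0 //.
by have := coord_le_eucl (Yn (s k) w - Y w) i; rewrite !mxE.
Qed.

(** * The factor through the stopped path: existence, dependence on the law, uniqueness *)

Section Factorization.
Context {R : realType} {T : R} {d : nat} (T_gt0 : 0 < T).
Context {d0 : measure_display} {Omt : measurableType d0}.
Variable P : probability Omt R.
Local Notation Om := (Omhat R T d).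
Local Notation L2path := (L2path R T d P).
Local Notation L2vec := (L2vec R d P).
Local Notation stop := (stop R T d).
Local Notation shiftp := (shiftp R T d).
Implicit Types (X : Omt -> Om) (psi phi : cpath R T d -> 'rV[R]_d).
Hypothesis hP : atomless R P.
Variable f : R -> (set Om -> \bar R) -> R.
Hypothesis hf : cont_Theta R T d f.
Variable t : R.
Hypothesis tT : 0 <= t <= T.
Variable DF : (Omt -> Om) -> Omt -> 'rV[R]_d.
Hypothesis hDF : forall X, L2path X -> L2vec (DF X) /\ frechet_at R T d P f t X (DF X).
Hypothesis hDFcont : forall (Xn : nat -> Omt -> Om) X,
  (forall n, L2path (Xn n)) -> L2path X ->
  (\int[P]_w ((dSK R T d (Xn n w) (X w)) ^+ 2)%:E)%E @[n --> \oo] --> 0%E ->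
  (\int[P]_w ((eucl (DF (Xn n) w - DF X w)) ^+ 2)%:E)%E @[n --> \oo] --> 0%E.

Let tT' : t <= T. Proof. by case/andP: tT. Qed.

(** Both expansions use one direction, the difference of the two derivatives; the perturbed paths
    then coincide pointwise after stopping. *)
Lemma derivative_stop X : L2path X ->
  {ae P, forall w, DF X w = DF (fun w => stop t (X w)) w}.
Proof.
move=> hX; have hS := L2path_stop T_gt0 P t X tT hX.
have [hY fr] := hDF _ hX; have [hY' fr'] := hDF _ hS.
have hxi := L2vecB P _ _ hY hY'.
apply: (L2vec_ae_eq P) => //.
apply: (frechet_same_law T_gt0 P f hf t _ _ _ _ _ _ tT hX hS hY hY' hxi hxi fr fr').
move=> c c0 A mA; congr (P _); apply/seteqP.
by split=> w /=; rewrite stop_shiftp_stop.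
Qed.

Lemma cvg_dSK_discretize X : L2path X ->
  (\int[P]_w (dSK R T d (discretize n (X w)) (X w) ^+ 2)%:E)%E @[n --> \oo] --> 0%E.
Proof.
move=> hX; have /L2pathP-/(_ T_gt0)[mX iX] := hX.
(* From [dSK_le_supn] and [supn_discretize], the distance is at most [2 * (3 * supn + 4 * d)],
   uniformly in [n]; [sqr_le_double_sum] squares this, and the coefficient 72 below is
   [8 * 3 ^ 2]. *)
pose G w : R := 8 * (3 * supn R T d (X w)) ^+ 2 + 1 * (8 * (4 * d%:R) ^+ 2).
have mG : measurable_fun setT G.
  apply: measurable_funD => //; apply: measurable_funM => //; apply: measurable_funX.
  by apply: measurable_funM => //; exact: measurable_supn.
have ub n w : dSK R T d (discretize n (X w)) (X w) ^+ 2 <= G w.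
  apply: sqr_le_double_sum; first exact: dSK_ge0.
  apply: le_trans (dSK_le_supn T_gt0 _ _) _; rewrite ler_pM2l //.
  have := supn_discretize T_gt0 n (X w); lra.
apply: (dominated_lower_cvg0 P (fun n w => dSK R T d (discretize n (X w)) (X w) ^+ 2) G) => //.
- by move=> n w; rewrite sqr_ge0 ub.
- have ic : P.-integrable setT (EFin \o cst (1 * (8 * (4 * d%:R) ^+ 2) : R)).
    exact: finite_measure_integrable_cst.
  apply/integrable_ge0P => //; first by move=> w; apply: le_trans (ub 0%N w); exact: sqr_ge0.
  have := integrable_comb P _ _ 72 1 iX ic.
  rewrite (_ : (fun w => _) = G) //; apply/funext => w; rewrite /G /cst; ring.
- move=> w; rewrite -[X in _ --> X](expr0n R 2).
  apply: (@cvg_comp _ _ _ (fun n => dSK R T d (discretize n (X w)) (X w)) (fun y : R => y ^+ 2)).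
    exact: dSK_discretize_cvg.
  exact: exprn_continuous.
Qed.

Lemma derivative_factorization X : L2path X ->
  exists2 psi, Fmeas R T d t psi & {ae P, forall w, DF X w = psi (stop t (X w))}.
Proof.
move=> hX; pose S w : Om := stop t (X w).
have hS : L2path S by exact: (L2path_stop T_gt0 P t X tT hX).
have [mS _] := hS.
pose Sn n w : Om := discretize n (S w).
have hSn n : L2path (Sn n) by exact: L2path_discretize.
have ex n : exists a : 'M[int]_(n.+2, d) -> 'rV[R]_d,
    {ae P, forall w, DF (Sn n) w = a (encode n (S w))}.
  have [hY fr] := hDF _ (hSn n).
  exact: (derivative_fiber_cst T_gt0 P hP f hf t tT _ (fun w => encode n (S w))
    (fun c => decode n c : Om) _ (measurable_encode T_gt0 n S mS) (hSn n) hY fr).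
pose a n := sval (cid (ex n)); have ha n := svalP (cid (ex n)).
have [s hs] : exists s : nat -> nat, {ae P, forall w, forall i,
    DF (Sn (s k)) w ord0 i @[k --> \oo] --> DF S w ord0 i}.
  apply: (L2_cvg_ae_subseq P (fun n => DF (Sn n)) (DF S)) => [n||].
  - by have [/L2vecP[]] := hDF _ (hSn n).
  - by have [/L2vecP[]] := hDF _ hS.
  - by apply: hDFcont => //; exact: cvg_dSK_discretize.
(* Stopping is part of [an], so grid values at times after [t] only repeat the value at [t]. When
   [psi] is evaluated at a stopped path, [stop_idem] removes the second stopping. *)
pose an k i (w : cpath R T d) : R := a (s k) (encode (s k) (stop t w)) ord0 i.
(* The extended limsup is defined on every path and [fine] sends infinite values to 0, so the
   witness is total and measurable; wherever the sequence converges it is the limit. *)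
exists (fun w => \row_i fine (limn_esup (fun k => (an k i w)%:E))).
  apply/FmeasP => i.
  rewrite (_ : (fun _ => _) = fine \o (fun w => limn_esup (fun k => (an k i w)%:E))); last first.
    by apply/funext => w; rewrite mxE.
  apply: measurableT_comp; first exact: fine_measurable.
  apply: measurable_fun_limn_esup => k; apply/measurable_EFinP => _ B _; rewrite setTI.
  have mst : measurable_fun setT
     (fun w : g_sigma_algebraType (coordG R T d t) => stop t w : Om).
    exact: (measurable_stop T_gt0 t (fun w => w) tT (@measurable_id _ _ _)).
  apply: (measurable_countable_fibers _ _ _
     (fun w : g_sigma_algebraType (coordG R T d t) => encode (s k) (stop t w))
     [set c | B (a (s k) c ord0 i)]).
  exact: (measurable_encode T_gt0 _ _ mst).
have ae1 : {ae P, forall w k, DF (Sn (s k)) w = a (s k) (encode (s k) (S w))}.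
  by apply: ae_foralln => k; exact: ha.
have ae2 := derivative_stop X hX.
apply: filterS3 ae1 ae2 hs => w h1 -> h3; apply/rowP => i; rewrite mxE.
have cv : (an k i (stop t (X w)))%:E @[k --> \oo] --> (DF S w ord0 i)%:E.
  apply: cvg_EFin; first exact: nearW.
  apply: cvg_trans (h3 i); apply: near_eq_cvg; apply: nearW => k /=.
  by rewrite /an stop_idem // h1.
by rewrite (cvg_limn_einf_sup cv).2.
Qed.

Lemma Fmeas_measurable psi (X : Omt -> Om) : Fmeas R T d t psi -> measurable_fun setT X ->
  vmeasurable (fun w => psi (X w)).
Proof.
move=> /FmeasP mpsi mX.
exact: (vmeasurable_comp (U := g_sigma_algebraType (coordG R T d t)) X psi
   (measurable_coordG_le _ _ X tT' mX) mpsi).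
Qed.

Lemma integral_same_law X X' (g : Om -> \bar R) :
  measurable_fun setT X -> measurable_fun setT X' ->
  (forall A : set Om, measurable A -> P (X @^-1` A) = P (X' @^-1` A)) ->
  measurable_fun setT g ->
  (\int[P]_w g (X w) = \int[P]_w g (X' w))%E.
Proof.
move=> mX mX' sl mg.
have [Q [QE Qint _]] := image_probability P X mX.
have [Q' [QE' Qint' _]] := image_probability P X' mX'.
have ge0 h : measurable_fun setT h -> (forall v, 0 <= h v)%E ->
    (\int[P]_w h (X w) = \int[P]_w h (X' w))%E.
  move=> mh h0; rewrite -(Qint h mh h0) -(Qint' h mh h0).
  apply: eq_measure_integral => A mA _.
  exact: etrans (QE A) (etrans (sl A mA) (esym (QE' A))).
have pE (Z : Omt -> Om) : ((fun w => g (Z w))^\+ = (fun w => g^\+ (Z w)))%E.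
  by apply/funext => w; rewrite !unlock.
have nE (Z : Omt -> Om) : ((fun w => g (Z w))^\- = (fun w => g^\- (Z w)))%E.
  by apply/funext => w; rewrite !unlock.
rewrite integralE [RHS]integralE !pE !nE; congr (_ - _)%E.
  exact: (ge0 (g^\+)%E (measurable_funepos mg) (funepos_ge0 g)).
exact: (ge0 (g^\-)%E (measurable_funeneg mg) (funeneg_ge0 g)).
Qed.

Lemma L2vec_ae (Y Y' : Omt -> 'rV[R]_d) : L2vec Y -> vmeasurable Y' ->
  {ae P, forall w, Y w = Y' w} -> L2vec Y'.
Proof.
move=> hY mY' YY'; have /L2vecP[mY _] := hY; have [_ iY] := hY.
split; first exact/vmeasurableP.
rewrite (ge0_ae_eq_integral (g := fun w => (eucl (Y w) ^+ 2)%:E)) //.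
- exact: measurable_eucl_sqr.
- exact: measurable_eucl_sqr.
- by move=> w _; rewrite lee_fin sqr_ge0.
- by move=> w _; rewrite lee_fin sqr_ge0.
by apply: filterS YY' => w -> _.
Qed.

Lemma same_law_factor X X' psi psi' : L2path X -> L2path X' ->
  (forall A : set Om, measurable A -> P (X' @^-1` A) = P (X @^-1` A)) ->
  Fmeas R T d t psi -> Fmeas R T d t psi' ->
  {ae P, forall w, DF X w = psi (stop t (X w))} ->
  {ae P, forall w, DF X' w = psi' (stop t (X' w))} ->
  {ae P, forall w, DF X' w = psi (stop t (X' w))}.
Proof.
move=> hX hX' sl mpsi mpsi' ae1 ae2.
pose S w : Om := stop t (X w); pose S' w : Om := stop t (X' w).
have [mS _] : L2path S by exact: (L2path_stop T_gt0 P t X tT hX).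
have [mS' _] : L2path S' by exact: (L2path_stop T_gt0 P t X' tT hX').
have mstop : measurable_fun setT (fun w : Om => stop t w : Om).
  exact: (measurable_stop (U := Om) T_gt0 t (fun w => w) tT
    (measurable_coordG_le (U := Om) t T (fun w => w) tT' (@measurable_id _ _ _))).
have slS (A : set Om) : measurable A -> P (S @^-1` A) = P (S' @^-1` A).
  move=> mA; apply: esym; apply: (sl ((fun w : Om => stop t w : Om) @^-1` A)).
  by rewrite -[X in measurable X]setTI; exact: mstop.
have mP psi0 : Fmeas R T d t psi0 -> @vmeasurable R d _ Om psi0.
  move=> /FmeasP h i; apply: (measurableT_comp (h i)).
  exact: (measurable_coordG_le (U := Om) t T (fun w => w) tT' (@measurable_id _ _ _)).
have [hD fr] := hDF _ hX; have [hD' fr'] := hDF _ hX'.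
have p1 : L2vec (fun w => psi (S w)).
  by apply: L2vec_ae hD _ ae1; exact: Fmeas_measurable.
have p2 : L2vec (fun w => psi' (S' w)).
  by apply: L2vec_ae hD' _ ae2; exact: Fmeas_measurable.
have transfer psi0 : Fmeas R T d t psi0 ->
    (\int[P]_w (eucl (psi0 (S w)) ^+ 2)%:E = \int[P]_w (eucl (psi0 (S' w)) ^+ 2)%:E)%E.
  move=> m0; apply: (integral_same_law S S' (fun v => (eucl (psi0 v) ^+ 2)%:E)) => //.
  by apply: measurable_eucl_sqr; exact: mP.
(* At this point [psi] is not yet tied to the derivative at [X']; square integrability of
   [psi (S' w)] is transferred from [psi (S w)] by equality of the stopped laws. *)
have p1' : L2vec (fun w => psi (S' w)).
  split; first by apply/vmeasurableP; exact: Fmeas_measurable.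
  by rewrite -transfer //; have [] := p1.
have p2' : L2vec (fun w => psi' (S w)).
  split; first by apply/vmeasurableP; exact: Fmeas_measurable.
  by rewrite transfer //; have [] := p2.
have hxi := L2vecB P _ _ p1 p2'; have hxi' := L2vecB P _ _ p1' p2.
pose dif (v : Om) := psi v - psi' v.
have main : fine (\int[P]_w (dotv (DF X w) (dif (S w)))%:E) =
    fine (\int[P]_w (dotv (DF X' w) (dif (S' w)))%:E).
  apply: (frechet_same_law T_gt0 P f hf t _ _ _ _ _ _ tT hX hX' hD hD' hxi hxi' fr fr').
  move=> c c0 A mA.
  (* Both stopped perturbed paths are images under the same measurable map [H], of [S] and of [S'],
     so equality of the stopped laws carries over. *)
  pose H (v : Om) : Om := stop t (shiftp t v (c *: dif v)).
  have mH : measurable_fun setT H.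
    apply: (measurable_stop T_gt0 t _ tT); apply: (measurable_coordG_le _ _ _ tT').
    apply: measurable_shiftp => //; apply: vmeasurableZ; apply: vmeasurableB; exact: mP.
  have HE (Z : Omt -> Om) :
      (fun w => stop t (shiftp t (Z w) (c *: dif (stop t (Z w)))) : Om) @^-1` A =
      (fun w => stop t (Z w) : Om) @^-1` (H @^-1` A).
    by apply/seteqP; split => w; rewrite /H /= stop_shiftp_stop.
  rewrite (HE X) (HE X'); apply: slS.
  by rewrite -[X in measurable X]setTI; exact: mH.
have ae_dot (D p xi : Omt -> 'rV[R]_d) : L2vec D -> L2vec p -> L2vec xi ->
    {ae P, forall w, D w = p w} ->
    (\int[P]_w (dotv (D w) (xi w))%:E = \int[P]_w (dotv (p w) (xi w))%:E)%E.
  move=> hD0 hp hx h; apply: ae_eq_integral => //.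
  - exact: (measurable_int P (integrable_dotv P _ _ hD0 hx)).
  - exact: (measurable_int P (integrable_dotv P _ _ hp hx)).
  by apply: filterS h => w -> _.
rewrite (ae_dot _ _ _ hD p1 hxi ae1) (ae_dot _ _ _ hD' p2 hxi' ae2) in main.
(* Moving the left side from [S] to [S'] leaves two pairings with the same direction [dif (S' w)],
   which is the situation of [L2vec_ae_eq] for [psi] and [psi']. *)
have tr : (\int[P]_w (dotv (psi (S w)) (dif (S w)))%:E =
           \int[P]_w (dotv (psi (S' w)) (dif (S' w)))%:E)%E.
  apply: (integral_same_law S S' (fun v => (dotv (psi v) (dif v))%:E)) => //.
  apply/measurable_EFinP; apply: measurable_dotv; first exact: mP.
  by apply: vmeasurableB; exact: mP.
rewrite tr in main.
have ae3 := L2vec_ae_eq P _ _ p1' p2 main.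
by apply: filterS2 ae2 ae3 => w -> ->.
Qed.

(** The set where the factors differ is measurable at time [t], hence invariant under stopping: [X]
    lies in it exactly when the stopped path does, which happens with probability 0. *)
Lemma factor_unique X psi phi : L2path X ->
  Fmeas R T d t psi -> Fmeas R T d t phi ->
  {ae P, forall w, DF X w = psi (stop t (X w))} ->
  {ae P, forall w, DF X w = phi (stop t (X w))} ->
  Fhat R T d t [set w | psi w <> phi w] /\ P (X @^-1` [set w | psi w <> phi w]) = 0%E.
Proof.
move=> [mX _] /FmeasP mpsi /FmeasP mphi ae1 ae2.
have FN : Fhat R T d t [set w | psi w <> phi w].
  rewrite (_ : [set w | _] = \bigcup_(i in [set: 'I_d])
     (setT `&` (fun w => psi w ord0 i - phi w ord0 i) @^-1` [set~ 0])).
    apply: (@fin_bigcup_measurable _ (g_sigma_algebraType (coordG R T d t))).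
      exact: finite_finset.
    move=> i _; apply: (measurable_funB (mpsi i) (mphi i)) => //.
    exact: measurableC.
  apply/seteqP; split => [w /= ne|w [i _ [_ /= ne]] /= e]; last first.
    by apply: ne; rewrite e subrr.
  apply: contrapT => h; apply: ne; apply/rowP => i; apply: contrapT => nei; apply: h.
  by exists i => //; split=> //= /eqP; rewrite subr_eq0 => /eqP.
split=> //; have mN : measurable (X @^-1` [set w | psi w <> phi w]).
  rewrite -[X in measurable X]setTI; apply: mX => //.
  exact: Fhat_le tT' _ FN.
have XE : X @^-1` [set w | psi w <> phi w] = [set w | psi (stop t (X w)) <> phi (stop t (X w))].
  by rewrite -(stop_preimage T_gt0 t _ tT FN).
apply: measure_negligible => //; rewrite XE.
have : {ae P, forall w, psi (stop t (X w)) = phi (stop t (X w))}.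
  by apply: filterS2 ae1 ae2 => w <- <-.
exact.
Qed.

End Factorization.

Theorem theorem2p2 (R : realType) (T : R) (d : nat) (hT : 0 < T) (hd : (1 <= d)%N)
  (f : R -> (set (Omhat R T d) -> \bar R) -> R) (hf : cont_Theta R T d f)
  (d0 : measure_display) (Omt : measurableType d0) (P : probability Omt R)
  (hpolish : polish_measurable R Omt) (hatom : atomless R P)
  (t : R) (ht : 0 <= t <= T)
  (DF : (Omt -> Omhat R T d) -> Omt -> 'rV[R]_d)
  (hDF : forall X, L2path R T d P X ->
           L2vec R d P (DF X) /\ frechet_at R T d P f t X (DF X))
  (hDFcont : forall (Xn : nat -> Omt -> Omhat R T d) (X : Omt -> Omhat R T d),
     (forall n, L2path R T d P (Xn n)) -> L2path R T d P X ->
     (fun n => \int[P]_w ((dSK R T d (Xn n w) (X w)) ^+ 2)%:E)%E @ \oo --> 0%E ->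
     (fun n => \int[P]_w ((eucl (DF (Xn n) w - DF X w)) ^+ 2)%:E)%E @ \oo --> 0%E) :
  forall X : Omt -> Omhat R T d, L2path R T d P X ->
  exists psi : cpath R T d -> 'rV[R]_d,
    [/\ Fmeas R T d t psi,
        {ae P, forall w, DF X w = psi (stop R T d t (X w))},
        (forall X' : Omt -> Omhat R T d, L2path R T d P X' ->
           (forall A : set (Omhat R T d), measurable A -> law R T d P X' A = law R T d P X A) ->
           {ae P, forall w, DF X' w = psi (stop R T d t (X' w))}) &
        (forall phi : cpath R T d -> 'rV[R]_d, Fmeas R T d t phi ->
           {ae P, forall w, DF X w = phi (stop R T d t (X w))} ->
           exists N : set (Omhat R T d),
             [/\ measurable N, law R T d P X N = 0%E &
                 [set w | psi w <> phi w] `<=` N])].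
Proof.
move=> X hX.
have [psi mpsi hpsi] := derivative_factorization hT P hatom f hf t ht DF hDF hDFcont X hX.
exists psi; split=> // [X' hX' sl|phi mphi hphi].
  (* The derivative at [X'] first gets a factor of its own, which the equality of laws then replaces
     by [psi]. *)
  have [psi' mpsi' hpsi'] := derivative_factorization hT P hatom f hf t ht DF hDF hDFcont X' hX'.
  exact: (same_law_factor hT P f hf t ht DF hDF X X' psi psi').
have [FN PN] := factor_unique hT P t ht DF X psi phi hX mpsi mphi hpsi hphi.
exists [set w | psi w <> phi w]; split=> //.
by apply: Fhat_le FN; case/andP: ht.
Qed.
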